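(* Let $\beta>1$ be a Parry number, and let $(\mathcal{U}_n)_{n\ge 0}$, $(\mathcal{A}_n)_{n\ge 0}$ and $\mathcal{L}$ be as in the context. Then the sequence $(\mathcal{U}_n)_{n\ge 0}$ converges to $\mathcal{L}$ with respect to the Hausdorff metric on the non-empty compact subsets of $\mathbb{R}^2$.
   Context: Binomial coefficients of words: for finite words $u,v$, $\binom{u}{v}$ is the number of occurrences of $v$ as a (scattered) subsequence of $u$; $\varepsilon$ is the empty word, $|w|$ the length of $w$, $w^\omega$ the infinite repetition of $w$. Setting. Let $\beta>1$ be real and $A_\beta=\{0,1,\ldots,\lceil\beta\rceil-1\}$. Every $x\in[0,1)$ has a greedy $\beta$-expansion $d_\beta(x)=c_1c_2\cdots$ over $A_\beta$ with $x=\sum_{j\ge1}c_j\beta^{-j}$ and $\sum_{i\ge j}c_i\beta^{-i}<\beta^{-j+1}$ for all $j\ge 1$. The $\beta$-expansion of $1$ is $d_\beta(1)=(\beta-1)^\omega$ if $\beta\in\mathbb{N}$, and otherwise $d_\beta(1)=(\lceil\beta\rceil-1)\,d_\beta\big(1-(\lceil\beta\rceil-1)/\beta\big)$. $\beta$ is a Parry number if $d_\beta(1)$ is ultimately periodic. The quasi-greedy expansion $d^*_\beta(1)$ is $(t_1\cdots t_{m-1}(t_m-1))^\omega$ if $d_\beta(1)=t_1\cdots t_m0^\omega$ with $t_m\neq 0$, and $d^*_\beta(1)=d_\beta(1)$ otherwise. Define $U_\beta=(U_\beta(n))_{n\ge0}$: if $d_\beta(1)=t_1\cdots t_m0^\omega$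 ($t_m\ne0$), set $U_\beta(0)=1$, $U_\beta(i)=t_1U_\beta(i-1)+\cdots+t_iU_\beta(0)+1$ for $1\le i\le m-1$, and $U_\beta(n)=t_1U_\beta(n-1)+\cdots+t_mU_\beta(n-m)$ for $n\ge m$; if $d_\beta(1)=t_1\cdots t_m(t_{m+1}\cdots t_{m+k})^\omega$ with $m,k$ minimal (and not of the previous form), set $U_\beta(0)=1$, $U_\beta(i)=t_1U_\beta(i-1)+\cdots+t_iU_\beta(0)+1$ for $1\le i\le m+k-1$, and for $n\ge m+k$, $U_\beta(n)=t_1U_\beta(n-1)+\cdots+t_{m+k}U_\beta(n-m-k)+U_\beta(n-k)-t_1U_\beta(n-k-1)-\cdots-t_mU_\beta(n-m-k)$. For $n\ge1$, $\mathrm{rep}_{U_\beta}(n)=c_{\ell-1}\cdots c_0$ is the greedy representation $n=\sum_{j}c_jU_\beta(j)$ with $c_{\ell-1}\ne0$ (obtained by successive Euclidean divisions), and $\mathrm{rep}_{U_\beta}(0)=\varepsilon$. Let $L=\mathrm{rep}_{U_\beta}(\mathbb{N})\subset A_\beta^*$, and $\mathrm{val}_{U_\beta}(d_r\cdots d_0)=\sum_{j=0}^r d_jU_\beta(j)$. For a finite word $w=w_n\cdots w_0$ write $0.w=\sum_{j=0}^n w_j\beta^{j-n-1}$ (with $0.\varepsilon=0$), and for an infinite word $0.w_1w_2\cdots=\sum_{j\ge1}w_j\beta^{-j}$. For a set of words $K$ and a word $u$, $u^{-1}.K=\{v: uv\in K\}$. The integer $p(u,v)$: for non-empty $u,v\in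 L$, $p(u,v)$ is the smallest non-negative integer $p$ such that $(u0^p)^{-1}.L=(v0^p)^{-1}.L=0^*L$ (such $p$ exists); also $p(\varepsilon,\varepsilon)=0$. A pair $(u,v)\in L\times L$ satisfies condition $(\star)$ if either $u=v=\varepsilon$, or $|u|\ge|v|>0$ and, with $p=p(u,v)$, $\binom{u0^p}{v0^p}\equiv1\pmod 2$ and $\binom{u0^p}{v0^pa}=0$ for all $a\in A_\beta$. Sets. Let $Q=[0,1]\times[0,1]$ and for $n\ge0$, $\mathcal{U}_n=\frac{1}{U_\beta(n)}\bigcup\{(\mathrm{val}_{U_\beta}(v),\mathrm{val}_{U_\beta}(u))+Q : u,v\in L,\ |u|\le n,\ \binom{u}{v}\equiv1\pmod2\}$. For $(u,v)$ satisfying $(\star)$, let $S_{u,v}$ be the closed segment with endpoints $A_{u,v}=(0.0^{|u|-|v|}v,\ 0.u)$ and $A_{u,v}+(\beta^{-|u|-p(u,v)},\beta^{-|u|-p(u,v)})$. Let $\mathcal{A}_0$ be the closure of $\bigcup_{(u,v)\text{ satisfying }(\star)}S_{u,v}$. Let $c(x,y)=(x/\beta,y/\beta)$ and $h(x,y)=(x,\beta y)$, and $\mathcal{A}_n=\bigcup_{0\le j\le i\le n}h^j(c^i(\mathcal{A}_0))$. The sequence $(\mathcal{A}_n)$ is a Cauchy sequence in the complete space of non-empty compact subsets of $\mathbb{R}^2$ with the Hausdorff metric (induced by the Euclidean distance); $\mathcal{L}$ denotes its limit.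
   Formalization: For non-integer β, d_β(1) is taken as (⌈β⌉−1) followed by d_β(β·(1−(⌈β⌉−1)/β)), i.e. the remainder is rescaled by β; the formula as printed omits this factor, does not represent 1 and makes the claim false (e.g. golden ratio). *)

(* Defs.v *)
From HB Require Import structures.
From mathcomp Require Export all_boot all_order all_algebra.
From mathcomp Require Export all_classical all_reals all_analysis.
Export Order.TTheory GRing.Theory Num.Theory.
Export numFieldNormedType.Exports.

Set Implicit Arguments.
Unset Strict Implicit.
Unset Printing Implicit Defensive.

Local Open Scope classical_set_scope.
Local Open Scope ring_scope.

(* A finite word w_n ... w_0 is a [seq nat] with its leftmost letter first; an
   infinite word c_1 c_2 ... is a function [c : nat -> nat], where [c i] stands
   for the letter c_(i+1). *)

Section Words.
Local Open Scope nat_scope.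

(* A mask of length |u| encodes a choice of positions in u. *)
Definition word_binom (u v : seq nat) : nat :=
  #|[pred b : (size u).-tuple bool | mask b u == v]|.

Definition zeros (p : nat) : seq nat := nseq p 0.

Definition left_quotient (u : seq nat) (K : set (seq nat)) : set (seq nat) :=
  [set w | K (u ++ w)].

Definition zero_star (K : set (seq nat)) : set (seq nat) :=
  [set w | exists i w', K w' /\ w = zeros i ++ w'].

End Words.

Section Shape.
Local Open Scope nat_scope.

(* t = t_1 ... t_m 0^omega with t_m <> 0 *)
Definition finite_expansion (t : nat -> nat) (m : nat) : Prop :=
  0 < m /\ t m.-1 <> 0 /\ (forall i, m <= i -> t i = 0).

(* t = t_1 ... t_m (t_(m+1) ... t_(m+k))^omega *)
Definition periodic_expansion (t : nat -> nat) (m k : nat) : Prop :=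
  0 < k /\ (forall i, m <= i -> t (i + k) = t i).

Definition minimal_periodic_expansion (t : nat -> nat) (m k : nat) : Prop :=
  periodic_expansion t m k /\
  (forall m' k', periodic_expansion t m' k' -> m <= m' /\ k <= k').

(* t_1 U(n-1) + ... + t_l U(n-l) *)
Definition conv (t U : nat -> nat) (l n : nat) : nat :=
  \sum_(j < l) t j * U (n - j.+1).

Definition initial_terms (t U : nat -> nat) (l : nat) : Prop :=
  U 0 = 1 /\ (forall i, 1 <= i < l -> U i = conv t U i i + 1).

End Shape.

(* The sequence U attached to the word t = d_beta(1). *)
Definition is_U (t U : nat -> nat) : Prop :=
  (forall m, finite_expansion t m ->
     initial_terms t U m /\
     (forall n, (m <= n)%N -> U n = conv t U m n)) /\
  ((~ exists m, finite_expansion t m) ->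
   forall m k, minimal_periodic_expansion t m k ->
     initial_terms t U (m + k) /\
     (forall n, (m + k <= n)%N ->
        (U n)%:Z = (conv t U (m + k) n)%:Z + (U (n - k)%N)%:Z
                   - (conv t U m (n - k))%:Z)).

Section Numeration.
Local Open Scope nat_scope.
Variable U : nat -> nat.

Fixpoint euclid_digits (l n : nat) : seq nat :=
  if l is l'.+1 then (n %/ U l') :: euclid_digits l' (n %% U l') else [::].

(* U increases strictly from U 0 = 1, so n < U n and the divisions may start at
   U n; the leading zeros produced are then erased, so that [rep 0 = [::]]. *)
Definition rep (n : nat) : seq nat :=
  let w := euclid_digits n.+1 n in drop (find (fun d => d != 0) w) w.

Definition val_word (w : seq nat) : nat :=
  \sum_(j < size w) nth 0 (rev w) j * U j.

Definition lang : set (seq nat) := range rep.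

Definition same_quotient (u v : seq nat) (p : nat) : Prop :=
  left_quotient (u ++ zeros p) lang = zero_star lang /\
  left_quotient (v ++ zeros p) lang = zero_star lang.

Definition puv (u v : seq nat) : nat :=
  if (u == [::]) && (v == [::]) then 0
  else get [set p | same_quotient u v p /\
                    (forall q, same_quotient u v q -> p <= q)].

End Numeration.

Section Expansions.
Variables (R : realType) (beta : R).

Definition ceil_beta : nat := `|Num.ceil beta|%N.

(* For x in [0, 1): c = d_beta(x). *)
Definition is_greedy_expansion (x : R) (c : nat -> nat) : Prop :=
  [/\ forall i, (c i < ceil_beta)%N,
      (fun n => \sum_(0 <= i < n) (c i)%:R * beta ^- i.+1) @ \oo --> x
    & forall j, limn (fun n => \sum_(j <= i < n) (c i)%:R * beta ^- i.+1)
                  < beta ^- j].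

Definition greedy_expansion (x : R) : nat -> nat :=
  get [set c | is_greedy_expansion x c].

(* For beta not an integer, the first digit ceil(beta) - 1 is followed by the
   expansion of beta * (1 - (ceil(beta) - 1) / beta), the remainder rescaled by
   beta: this is what makes the word represent 1. *)
Definition expansion1 : nat -> nat :=
  if beta \is a Num.nat then fun=> ceil_beta.-1
  else fun i => if i is i'.+1
                then greedy_expansion (beta * (1 - ceil_beta.-1%:R / beta)) i'
                else ceil_beta.-1.

Definition parry : Prop := exists m k, periodic_expansion expansion1 m k.

Definition Ubeta : nat -> nat := get [set U | is_U expansion1 U].

Definition Lbeta : set (seq nat) := lang Ubeta.

(* 0.w *)
Definition frac_word (w : seq nat) : R :=
  \sum_(i < size w) (nth 0%N w i)%:R * beta ^- i.+1.

Definition cond_star (u v : seq nat) : Prop :=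
  Lbeta u /\ Lbeta v /\
  ((u = [::] /\ v = [::]) \/
   [/\ (0 < size v <= size u)%N,
       odd (word_binom (u ++ zeros (puv Ubeta u v)) (v ++ zeros (puv Ubeta u v)))
     & forall a, (a < ceil_beta)%N ->
         word_binom (u ++ zeros (puv Ubeta u v))
                    (rcons (v ++ zeros (puv Ubeta u v)) a) = 0%N]).

Definition U_set (n : nat) : set (R * R) :=
  [set z | exists u v : seq nat,
     [/\ Lbeta u, Lbeta v, (size u <= n)%N & odd (word_binom u v)] /\
     exists q : R * R, 0 <= q.1 <= 1 /\ 0 <= q.2 <= 1 /\
       z = (((val_word Ubeta v)%:R + q.1) / (Ubeta n)%:R,
            ((val_word Ubeta u)%:R + q.2) / (Ubeta n)%:R)].

Definition segment_uv (u v : seq nat) : set (R * R) :=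
  [set z | exists s : R, 0 <= s <= 1 /\
     z = (frac_word (zeros (size u - size v) ++ v)
            + s * beta ^- (size u + puv Ubeta u v),
          frac_word u + s * beta ^- (size u + puv Ubeta u v))].

Definition A0_set : set (R * R) :=
  closure [set z | exists u v, cond_star u v /\ segment_uv u v z].

Definition c_map (z : R * R) : R * R := (z.1 / beta, z.2 / beta).
Definition h_map (z : R * R) : R * R := (z.1, beta * z.2).

Definition A_set (n : nat) : set (R * R) :=
  [set z | exists i j : nat, (j <= i <= n)%N /\
     ((fun z => iter j h_map (iter i c_map z)) @` A0_set) z].

End Expansions.

Section Hausdorff.
Variable R : realType.

Definition euclid_dist (x y : R * R) : R :=
  Num.sqrt ((x.1 - y.1) ^+ 2 + (x.2 - y.2) ^+ 2).

Definition fattening (S : set (R * R)) (e : R) : set (R * R) :=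
  [set x | exists s, S s /\ euclid_dist x s <= e].

Definition hausdorff_dist (S T : set (R * R)) : R :=
  inf [set e | 0 <= e /\ S `<=` fattening T e /\ T `<=` fattening S e].

(* Convergence in the space of nonempty compact subsets of the plane. The
   topology of R * R in the library is the Euclidean one. *)
Definition hausdorff_cvg (F : nat -> set (R * R)) (K : set (R * R)) : Prop :=
  [/\ forall n, F n !=set0 /\ compact (F n),
      K !=set0 /\ compact K
    & (fun n => hausdorff_dist (F n) K) @ \oo --> (0 : R)].

Definition hausdorff_lim (F : nat -> set (R * R)) : set (R * R) :=
  get [set K | hausdorff_cvg F K].

End Hausdorff.

Definition limit_set (R : realType) (beta : R) : set (R * R) :=
  hausdorff_lim (A_set beta).

(* Main.v *)
From mathcomp Require Import ring lra zify.
Require Import Defs.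

Set Implicit Arguments.
Unset Strict Implicit.
Unset Printing Implicit Defensive.

Local Open Scope ring_scope.

(* Every admissible pair (u,v) yields a point P_n(u,v) = (val v, val u)/beta^n,
   where val is taken in base beta; since U(n) ~ C beta^n (a renewal theorem for
   the recurrence satisfied by U), the set U_n is asymptotically the set of these
   points.  If binom(u,v) is odd and K is a power of 2 larger than |u|, then
   (u0^K1, v0^K1) satisfies condition (star): modulo 2, appending a zero to both
   words acts as 1 + shift, so appending K zeros acts as 1 + shift^K.  Hence
   P_n(u,v) is within beta^-n of A_n.  Conversely a point of h^j c^i S_(u,v) is
   approximated by the pairs (u0^p w0^r1 0^j, v0^p w0^r1): appending a common
   suffix to a (star) pair preserves the parity, and because of the final 1 the
   trailing zeros 0^j of the first word create no new occurrence.  Finally A_n is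
   increasing and bounded, so it converges to the closure of its union. *)

(** * Binomial coefficients of words *)

(** Both recurrences defining U reduce to U(n) = t_1 U(n-1) + ... + t_n U(0) + 1, with t the
    quasi-greedy expansion of 1. Its remainders r_j stay in (0,1]: this lets greedy words be
    compared with factors of t, and makes the weights t_j beta^-j sum to 1. The renewal argument
    tests windows of values of U(n)/beta^n near the upper limit, then near the lower limit, against
    the identity sum_j U(n-j) r_j = 1 + beta + ... + beta^n, which forces the two limits to agree.
    The obstacle in comparing the sets is that p(u,v) has no explicit value. It exists because a
    greedy word u leaves a gap 1 - 0.u > 0, which a suffix placed after enough zeros cannot close.
    Condition (star) for a lengthened pair is obtained without knowing its p: the final 1 makes the
    pair rigid against every further letter, and rigidity survives any common suffix, in particular
    0^p. Pairs with v empty escape this construction and are matched with images of the diagonal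
    segment of the empty pair. A finite grid turns pointwise approximation into Hausdorff
    approximation. *)

Section WordBinomials.
Local Open Scope nat_scope.
Implicit Types (u v w : seq nat) (a b : nat).

Lemma word_binomE n u v : size u = n ->
  word_binom u v = \sum_(m : n.-tuple bool) (mask m u == v).
Proof. by move=> <-; rewrite /word_binom -sum1_card big_mkcond; apply: eq_bigr => m _; rewrite inE. Qed.

(** Pascal's rule: the last bit of a mask tells whether the last letter of the long word is used;
    [f] and [g] split off this bit. *)
Lemma word_binom_rcons u v a b :
  word_binom (rcons u a) (rcons v b) =
  word_binom u (rcons v b) + (a == b) * word_binom u v.
Proof.
pose f (p : (size u).-tuple bool * bool) : (size u).+1.-tuple bool :=
  [tuple of rcons p.1 p.2].
pose g (m : (size u).+1.-tuple bool) : (size u).-tuple bool * bool :=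
  ([tuple of belast (thead m) (behead m)], last (thead m) (behead m)).
have fK : cancel f g.
  case=> m c; congr pair; first apply/val_inj => /=.
    by case: m => -[|x m] i //=; rewrite /thead (tnth_nth false) /= belast_rcons.
  by case: m => -[|x m] i //=; rewrite /thead (tnth_nth false) /= last_rcons.
have gK : cancel g f.
  by move=> m; apply/val_inj; case: m => -[|x m] i //=;
    rewrite /thead (tnth_nth false) /= -lastI.
rewrite (word_binomE (n := (size u).+1)) ?size_rcons//.
rewrite (reindex f) /=; last by exists g => x _; [exact: fK|exact: gK].
rewrite -(pair_bigA _ (fun (m : (size u).-tuple bool) (c : bool) => nat_of_bool (mask (rcons m c) (rcons u a) == rcons v b))) /=.
rewrite !(word_binomE (n := size u))// big_distrr -big_split; apply: eq_bigr => m _ /=.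
rewrite big_bool !mask_rcons ?size_tuple//= cats0 addnC cats1 eqseq_rcons.
by case: (_ == v); case: (a == b).
Qed.

Lemma word_binom_gt0 u v : (0 < word_binom u v) = subseq v u.
Proof.
apply/card_gt0P/subseqP => [[m]|[m sm ->]].
  by rewrite inE => /eqP <-; exists m; rewrite ?size_tuple.
by exists (tcast sm (in_tuple m)); rewrite inE val_tcast.
Qed.

Lemma word_binom_eq0 u v : (word_binom u v == 0) = ~~ subseq v u.
Proof. by rewrite -word_binom_gt0 lt0n negbK. Qed.

Lemma word_binom_nil : word_binom [::] [::] = 1.
Proof.
by rewrite (word_binomE (n := 0))// (eq_bigr (fun=> 1)) ?sum1_card ?card_tuple//
  => m _; rewrite (tuple0 m).
Qed.

Lemma word_binom_rcons_eq0 u v a : word_binom u v = 0 -> word_binom u (rcons v a) = 0.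
Proof.
move=> /eqP; rewrite word_binom_eq0 => /negP uv; apply/eqP; rewrite word_binom_eq0.
by apply/negP => /(subseq_trans (subseq_rcons v a)).
Qed.

Lemma word_binom_cat_notin u z v b : b \notin z ->
  word_binom (u ++ z) (rcons v b) = word_binom u (rcons v b).
Proof.
elim/last_ind: z => [|z a IH]; first by rewrite cats0.
rewrite mem_rcons inE negb_or => /andP[ba bz].
by rewrite -rcons_cat word_binom_rcons eq_sym (negbTE ba) addn0 IH.
Qed.

(** The binomial conditions of (star), freed from the zeros 0^p. The alphabet is a parameter because
    (star) speaks of the letters of A_beta only, while pairs ending in 0...01 are rigid against all
    letters. *)
Definition rigid (D : pred nat) u v :=
  odd (word_binom u v) /\ forall a, D a -> word_binom u (rcons v a) = 0.

(** In Pascal's rule for a common letter a, the term counting [rcons v a] in [u] vanishes, so the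
    parity passes on unchanged; the same vanishing gives rigidity of the longer pair. *)
Lemma rigid_cat (D : pred nat) u v w : all D w -> rigid D u v -> rigid D (u ++ w) (v ++ w).
Proof.
elim: w u v => [|a w IH] u v; rewrite ?cats0//= => /andP[Da Dw] [ouv uv0].
rewrite -!cat_rcons; apply: IH => //; split=> [|b Db].
  by rewrite word_binom_rcons eqxx mul1n uv0.
by rewrite word_binom_rcons uv0// muln0 addn0 word_binom_rcons_eq0// uv0.
Qed.

Lemma zerosS k : zeros k.+1 = rcons (zeros k) 0.
Proof. by rewrite /zeros -addn1 nseqD cats1. Qed.

(* Freshman's dream: appending a zero to both words acts as 1 + shift, whose
   2^r-th power modulo 2 is 1 + shift^(2^r). *)
Lemma odd_word_binom_zeros u v r k i :
  odd (word_binom (u ++ zeros (k + 2 ^ r)) (v ++ zeros (i + 2 ^ r))) =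
  odd (word_binom (u ++ zeros k) (v ++ zeros (i + 2 ^ r)))
  (+) odd (word_binom (u ++ zeros k) (v ++ zeros i)).
Proof.
elim: r k i => [|r IH] k i.
  by rewrite !addn1 !zerosS -!rcons_cat word_binom_rcons eqxx mul1n oddD.
rewrite expnS mul2n -addnn !addnA !IH.
by rewrite -addbA addKb.
Qed.

Lemma word_binom_size u v : size u < size v -> word_binom u v = 0.
Proof.
move=> uv; apply/eqP; rewrite word_binom_eq0; apply/negP => /size_subseq.
by rewrite leqNgt uv.
Qed.

(** Since |u| < 2^r, the word v0^(2^r) is too long to occur in u, so the shifted term of the mod 2
    identity disappears. An occurrence of v0^(2^r)1 in u0^(2^r) would have to lie inside u, hence
    none exists, and nothing can follow the final 1. *)
Lemma rigid_zeros1 u v r : odd (word_binom u v) -> size u < 2 ^ r ->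
  rigid predT (u ++ zeros (2 ^ r) ++ [:: 1]) (v ++ zeros (2 ^ r) ++ [:: 1]).
Proof.
move=> ouv ur; set k := 2 ^ r in ur *; rewrite !cats1 -!rcons_cat.
have N1 : word_binom (u ++ zeros k) (rcons (v ++ zeros k) 1) = 0.
  rewrite word_binom_cat_notin ?mem_nseq ?andbF// word_binom_size//.
  by rewrite size_rcons size_cat size_nseq ltnS (leq_trans (ltnW ur))// leq_addl.
split=> [|a _].
  rewrite word_binom_rcons eqxx mul1n N1 add0n.
  have := odd_word_binom_zeros u v r 0 0; rewrite -/k !add0n /= !cats0 => ->.
  by rewrite ouv word_binom_size ?size_cat ?size_nseq// (leq_trans ur)// leq_addl.
by rewrite word_binom_rcons N1 muln0 addn0 word_binom_rcons_eq0.
Qed.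

End WordBinomials.

(** * Greedy words *)

Section GreedyWords.
Local Open Scope nat_scope.
Variable U : nat -> nat.
Implicit Types (u v w : seq nat) (a n : nat).

Lemma val_word_nil : val_word U [::] = 0.
Proof. by rewrite /val_word big_ord0. Qed.

Lemma val_word_cons a w : val_word U (a :: w) = a * U (size w) + val_word U w.
Proof.
rewrite /val_word /= big_ord_recr /= rev_cons nth_rcons size_rev ltnn eqxx addnC.
by congr (_ + _); apply: eq_bigr => i _; rewrite nth_rcons size_rev ltn_ord.
Qed.

Lemma val_wordE w : val_word U w = \sum_(j < size w) nth 0 w j * U (size w - j.+1).
Proof.
elim: w => [|a w IH]; first by rewrite val_word_nil big_ord0.
by rewrite val_word_cons /= big_ord_recl /= subn1 /= IH; congr (_ + _);
  apply: eq_bigr => i _; rewrite /= /bump add1n subSS.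
Qed.

Lemma val_word_zeros k w : val_word U (zeros k ++ w) = val_word U w.
Proof. by elim: k => //= k IH; rewrite val_word_cons mul0n add0n. Qed.

(** Membership in 0^* L. Allowing leading zeros makes the property stable under suffixes, so that it
    can be handled by induction on words. *)
Fixpoint greedy w : bool :=
  if w is _ :: w' then (val_word U w < U (size w)) && greedy w' else true.

Lemma greedy_catr u w : greedy (u ++ w) -> greedy w.
Proof. by elim: u => //= a u IH /andP[_ /IH]. Qed.

Hypothesis U0 : U 0 = 1.
Hypothesis U_incr : forall n, U n < U n.+1.

Lemma U_gtn n : n < U n.
Proof. by elim: n => [|n IH]; [rewrite U0 | exact: leq_ltn_trans (U_incr n)]. Qed.

Lemma U_gt0 n : 0 < U n.
Proof. exact: leq_ltn_trans (U_gtn n). Qed.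

Lemma leq_U m n : m <= n -> U m <= U n.
Proof. by apply: (homo_leq leqnn leq_trans) => i; exact: ltnW. Qed.

Lemma greedy_val w : greedy w -> val_word U w < U (size w).
Proof. by case: w => [|a w /= /andP[]//]; rewrite val_word_nil U0. Qed.

Lemma greedy_zeros k w : greedy (zeros k ++ w) = greedy w.
Proof.
elim: k => //= k IH; rewrite -IH andb_idl// => /greedy_val wU.
by rewrite val_word_cons mul0n add0n (ltn_trans wU).
Qed.

Lemma greedy_1zeros j : greedy (1 :: zeros j).
Proof.
rewrite /= val_word_cons mul1n size_nseq -[zeros j]cats0 val_word_zeros.
by rewrite val_word_nil addn0 U_incr greedy_zeros.
Qed.

Lemma size_euclid_digits l n : size (euclid_digits U l n) = l.
Proof. by elim: l n => //= l IH n; rewrite IH. Qed.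

Lemma val_euclid_digits l n : n < U l -> val_word U (euclid_digits U l n) = n.
Proof.
elim: l n => [|l IH] n nU /=; first by move: nU; rewrite U0 val_word_nil; case: n.
by rewrite val_word_cons size_euclid_digits IH ?ltn_mod ?U_gt0// -divn_eq.
Qed.

Lemma greedy_euclid_digits l n : n < U l -> greedy (euclid_digits U l n).
Proof.
elim: l n => [|l IH] n nU //=; rewrite IH ?ltn_mod ?U_gt0// andbT.
by have /= -> := val_euclid_digits nU; rewrite size_euclid_digits.
Qed.

Lemma euclid_digits_val w : greedy w -> euclid_digits U (size w) (val_word U w) = w.
Proof.
elim: w => //= a w IH /andP[_ gw]; have vw := greedy_val gw.
by rewrite val_word_cons divnMDl ?U_gt0// divn_small// addn0 modnMDl modn_small// IH.
Qed.

Lemma drop_find_zeros w :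
  w = zeros (find (fun d => d != 0) w) ++ drop (find (fun d => d != 0) w) w.
Proof. by elim: w => //= -[|a] w IH //=; rewrite -IH. Qed.

Lemma head_drop_find w : head 1 (drop (find (fun d => d != 0) w) w) != 0.
Proof. by elim: w => //= -[|a] w IH. Qed.

(** The default [1] of [head] lets the empty word, which represents 0, pass the test on the leading
    letter. *)
Lemma langP w : lang U w <-> greedy w /\ head 1 w != 0.
Proof.
split=> [[n _ <-]|[gw hw]].
  split; last exact: head_drop_find.
  rewrite /rep -(greedy_zeros (find (fun d => d != 0) (euclid_digits U n.+1 n))).
  by rewrite -drop_find_zeros greedy_euclid_digits// ltnW// U_gtn.
exists (val_word U w) => //; rewrite /rep; set n := val_word U w.
have wn : size w <= n.+1.
  rewrite ltnW// ltnS /n; case: w hw {gw n} => // -[|a] w _ //=.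
  by rewrite val_word_cons mulSn -addnA (leq_trans (U_gtn _)) ?leq_addr.
(* The divisions in [rep] start at [U n], so they return w padded with zeros to length n + 1; [wn]
   guarantees that this length is at least that of w. *)
have := greedy_zeros (n.+1 - size w) w; rewrite gw => /euclid_digits_val.
rewrite val_word_zeros size_cat size_nseq subnK// => ->.
by elim: (_ - _) => //=; case: w hw {n gw wn} => //= -[|a] w.
Qed.

End GreedyWords.

(** * Values of words in base beta *)

Section FracWord.
Variables (R : realType) (beta : R).
Hypothesis beta_neq0 : beta != 0.
Implicit Types (u w : seq nat) (a k : nat).

Lemma frac_word_nil : frac_word beta [::] = 0.
Proof. by rewrite /frac_word big_ord0. Qed.

Lemma frac_word_cons a w : frac_word beta (a :: w) = (a%:R + frac_word beta w) / beta.
Proof.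
rewrite /frac_word /= big_ord_recl /= expr1 mulrDl mulr_suml; congr (_ + _).
by apply: eq_bigr => i _; rewrite /bump /= add1n -mulrA -invfM -exprSr.
Qed.

Lemma frac_word_cat u w :
  frac_word beta (u ++ w) = frac_word beta u + frac_word beta w / beta ^+ size u.
Proof.
elim: u => [|a u IH] /=; first by rewrite frac_word_nil expr0 divr1 add0r.
by rewrite !frac_word_cons IH addrA [LHS]mulrDl exprSr invfM mulrA.
Qed.

Lemma frac_word_zeros k : frac_word beta (zeros k) = 0.
Proof. by elim: k => [|k /= IH]; rewrite ?frac_word_nil// frac_word_cons IH addr0 mul0r. Qed.

End FracWord.

Lemma frac_word_ge0 (R : realType) (beta : R) w : 0 < beta -> 0 <= frac_word beta w.
Proof.
move=> b0; elim: w => [|a w IH]; first by rewrite frac_word_nil.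
by rewrite frac_word_cons divr_ge0 ?addr_ge0 ?ler0n// ltW.
Qed.

(** [r j] is the remainder of 1 after j digits, scaled by beta^j. Remainders in (0,1], instead of
    [0,1), single out d^*_beta(1): each digit is the largest integer strictly below beta times the
    remainder. *)
Definition quasi_greedy (R : realType) (beta : R) (t : nat -> nat) (r : nat -> R) :=
  [/\ r 0%N = 1, forall j, r j.+1 = beta * r j - (t j)%:R & forall j, 0 < r j <= 1].

Definition tword (t : nat -> nat) i n := map t (iota i n).

(** * Comparison of greedy words with factors of the quasi-greedy expansion *)

Section QuasiGreedy.
Variables (R : realType) (beta : R) (t : nat -> nat) (r : nat -> R) (U : nat -> nat).
Hypothesis beta_gt1 : 1 < beta.
Hypothesis rt : quasi_greedy beta t r.
Hypothesis U_rec : forall n, U n = (conv t U n n).+1.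
Implicit Types (w : seq nat).

Let beta_gt0 : 0 < beta. Proof. exact: lt_trans beta_gt1. Qed.
Let r0 : r 0 = 1. Proof. by case: rt. Qed.
Let rS j : r j.+1 = beta * r j - (t j)%:R. Proof. by case: rt. Qed.
Let r_gt0 j : 0 < r j. Proof. by case: rt => _ _ /(_ j)/andP[]. Qed.
Let r_le1 j : r j <= 1. Proof. by case: rt => _ _ /(_ j)/andP[]. Qed.

Let brE j : beta * r j = (t j)%:R + r j.+1. Proof. by rewrite rS addrC subrK. Qed.

Lemma t0_gt0 : (0 < t 0)%N.
Proof.
rewrite lt0n; apply/eqP => t00; have := brE 0.
by rewrite t00 add0r r0 mulr1 => bE; have := r_le1 1; rewrite -bE leNgt beta_gt1.
Qed.

Lemma U_tword n : U n = (val_word U (tword t 0 n)).+1.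
Proof.
rewrite {1}U_rec val_wordE /conv size_map size_iota; congr _.+1.
by apply: eq_bigr => j _; rewrite (nth_map 0%N) ?size_iota// nth_iota.
Qed.

Lemma quasi_greedy_U0 : U 0 = 1%N.
Proof. by rewrite U_tword val_word_nil. Qed.

(** An integer form of Parry's lexicographic condition. If the first digits differ, the tail after
    the smaller one is dominated by a prefix of [t], because every remainder is at most r 0 = 1, and
    that prefix has value one less than [U] at its length. A larger first digit at i would
    contradict r i <= r k, the remainders lying in (0,1]. *)
Lemma val_tword_homo n i k : r i <= r k ->
  (val_word U (tword t i n) <= val_word U (tword t k n))%N.
Proof.
elim: n i k => [|n IH] i k rik; first by rewrite !val_word_nil.
have := ler_wpM2l (ltW beta_gt0) rik; rewrite !brE => tr.
rewrite /= !val_word_cons !size_map !size_iota.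
have [tik|tki|tE] := ltngtP (t i) (t k).
- have := IH i.+1 0%N; rewrite r0 r_le1 => /(_ isT); rewrite -ltnS -U_tword => vU.
  rewrite (leq_trans _ (leq_addr _ _))// (leq_trans _ (leq_mul tik (leqnn _)))//.
  by rewrite mulSn addnC leq_add2r ltnW.
- have : (t k)%:R + 1 <= (t i)%:R :> R by rewrite natr1 ler_nat.
  by have := r_le1 k.+1; have := r_gt0 i.+1; lra.
- by rewrite tE leq_add2l IH//; move: tr; rewrite tE lerD2l.
Qed.

Lemma val_tword_lt n i : (val_word U (tword t i n) < U n)%N.
Proof. by rewrite U_tword ltnS val_tword_homo// r0. Qed.

Lemma U_ltn n : (U n < U n.+1)%N.
Proof.
rewrite [X in (_ < X)%N]U_tword /= val_word_cons size_map size_iota ltnS.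
by rewrite (leq_trans _ (leq_addr _ _))// leq_pmull ?t0_gt0.
Qed.

Lemma U_leq n : (U n.+1 <= (t 0).+1 * U n)%N.
Proof.
by rewrite U_tword /= val_word_cons size_map size_iota mulSn addnC -addSn leq_add2r val_tword_lt.
Qed.

Lemma frac_tword k n : frac_word beta (tword t k n) = r k - r (k + n) / beta ^+ n.
Proof.
elim: n k => [|n IH] k; first by rewrite frac_word_nil addn0 expr0 divr1 subrr.
rewrite /= frac_word_cons IH addrA -brE mulrBl mulrAC mulfV ?gt_eqF// mul1r addnS addSn.
by rewrite exprSr invfM mulrA.
Qed.

Let g0 := greedy_val quasi_greedy_U0.

Lemma greedy_digits w : greedy U w -> all (fun a => a < (t 0).+1)%N w.
Proof.
elim: w => //= a w IH /andP[aw /IH ->]; rewrite andbT.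
move: aw; rewrite val_word_cons => aw.
have := leq_trans (leq_ltn_trans (leq_addr _ _) aw) (U_leq _).
by rewrite ltn_mul2r => /andP[].
Qed.

(** Carries an inequality between U-values over to base beta. Only k = 0 is wanted in the end, but
    after equal first digits the comparison moves on to the next factor of [t]. *)
Lemma frac_word_le_tword w k : greedy U w ->
  (val_word U w <= val_word U (tword t k (size w)))%N ->
  frac_word beta w <= frac_word beta (tword t k (size w)).
Proof.
elim: w k => [|a w IH] k; first by rewrite frac_word_nil.
move=> /= /andP[_ gw]; have vw := g0 gw.
have fw : frac_word beta w < 1.
  rewrite (le_lt_trans (IH 0%N gw _))//; first by rewrite -ltnS -U_tword.
  by rewrite frac_tword r0 ltrBlDr ltrDl divr_gt0// exprn_gt0.
rewrite !val_word_cons size_map size_iota !frac_word_cons ler_pM2r ?invr_gt0// => vv.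
have [ak|ka|aE] := ltngtP a (t k).
- have : a%:R + 1 <= (t k)%:R :> R by rewrite natr1 ler_nat.
  by have := @frac_word_ge0 R beta (tword t k.+1 (size w)) beta_gt0; rewrite /tword; lra.
- have := leq_trans (leq_mul ka (leqnn (U (size w)))) (leq_trans (leq_addr _ _) vv).
  by rewrite mulSn addnC leq_add2l leqNgt val_tword_lt.
- by rewrite aE lerD2l IH//; move: vv; rewrite aE leq_add2l.
Qed.

Lemma frac_word_lt1 w : greedy U w -> frac_word beta w < 1.
Proof.
move=> gw; have := g0 gw; rewrite U_tword ltnS => /(frac_word_le_tword gw).
move=> /le_lt_trans; apply.
by rewrite frac_tword r0 ltrBlDr ltrDl divr_gt0// exprn_gt0.
Qed.

End QuasiGreedy.

(** * A renewal theorem *)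

Section Renewal.
Local Open Scope classical_set_scope.
Variable R : realType.
Implicit Types (f p s e : nat -> R).

Lemma cvg0_near f (d : R) : f @ \oo --> 0 -> 0 < d -> \forall n \near \oo, `|f n| <= d.
Proof. by move=> /cvgr0_norm_le; apply. Qed.

Lemma limsup_exists f (B : R) : (forall n, `|f n| <= B) ->
  exists2 M, forall d : R, 0 < d -> \forall n \near \oo, f n <= M + d
    & forall (d : R) N, 0 < d -> exists2 n, (N <= n)%N & M - d <= f n.
Proof.
move=> fB; pose S := [set x | \forall n \near \oo, f n <= x].
have fle n : - B <= f n <= B by rewrite -ler_norml.
have S0 : has_inf S.
  split; first by exists B; apply: nearW => n; have /andP[] := fle n.
  exists (- B) => x [N _ /(_ N (leqnn N)) /=]; apply: le_trans.
  by have /andP[] := fle N.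
exists (inf S) => [d d0|d N d0].
  have [x xS xd] := inf_adherent d0 S0.
  by apply: filterS xS => n /le_trans; apply; exact: ltW.
apply: contrapT => H; have : S (inf S - d).
  exists N => // n /= Nn; rewrite leNgt; apply/negP => nd; apply: H.
  by exists n => //; exact: ltW.
by move=> /(ge_inf S0.2); rewrite /= lerBrDr gerDl leNgt d0.
Qed.

(* At a near-maximal value of a weighted average of the past, each past value
   of positive weight is near-maximal too. *)
Lemma renewal_limsup f p s e (B : R) :
  (forall n, `|f n| <= B) -> (forall j, 0 <= p j) -> 0 < p 0%N ->
  (forall n, \sum_(0 <= j < n) p j = 1 - s n) -> (forall n, 0 <= s n) ->
  s @ \oo --> 0 -> e @ \oo --> 0 ->
  (forall n, f n.+1 = \sum_(0 <= j < n.+1) p j * f (n - j)%N + e n) ->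
  exists2 M, forall d : R, 0 < d -> \forall n \near \oo, f n <= M + d
    & forall K (d : R) N, 0 < d ->
        exists2 n, (N + K <= n)%N & forall i, (i <= K)%N -> M - d <= f (n - i)%N.
Proof.
move=> fB p_ge0 p0 ps s_ge0 s0 e0 frec.
have [M Mub Mfreq] := limsup_exists fB; exists M => //.
have fle n : - B <= f n <= B by rewrite -ler_norml.
have B0 : 0 <= B by apply: le_trans (fB 0%N).
have MB : - B <= M.
  apply/ler_addgt0Pr => d d0; have [N _ /(_ N (leqnn N))/=] := Mub _ d0.
  by apply: le_trans; have /andP[] := fle N.
(* With g = M + eta - f, near-maximality at m + 1 bounds the weighted sum of g by 2 eta, up to
   errors below eta. As g is nonnegative at recent indices, p 0 * g m <= 3 eta <= p 0 * d. *)
have step (d : R) : 0 < d -> exists2 eta, 0 < eta <= d &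
    \forall m \near \oo, M - eta <= f m.+1 -> M - d <= f m.
  move=> d0; pose eta := Num.min d (d * p 0%N / 3).
  have eta0 : 0 < eta by rewrite lt_min d0 divr_gt0 ?mulr_gt0.
  exists eta; first by rewrite eta0 ge_min lexx.
  have [N _ HN] := Mub _ eta0.
  (* Chosen so that the two errors due to the tail [s] add up to at most eta / 3; the summand 1
     keeps [c] positive. *)
  pose c := 3 * (`|M + eta| + 2 * B + 1).
  have c0 : 0 < c by rewrite mulr_gt0// ltr_wpDl ?addr_ge0 ?mulr_ge0.
  have ec0 : 0 < eta / c by rewrite divr_gt0.
  have [N1 _ HN1] := cvg0_near s0 ec0.
  have eta30 : 0 < eta / 3 by rewrite divr_gt0.
  have [N2 _ HN2] := cvg0_near e0 eta30.
  exists (N + N1 + N2)%N => // m /= Nm fm.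
  have sle n : (N1 <= n)%N -> s n <= eta / c.
    by move=> /HN1 /=; rewrite ger0_norm.
  have em : e m <= eta / 3.
    by rewrite (le_trans (ler_norm _))// HN2 //= (leq_trans _ Nm)// leq_addl.
  pose g n := M + eta - f n.
  have g_ge n : - (2 * B) <= g n by rewrite /g; have /andP[] := fle n; lra.
  have gN n : (N <= n)%N -> 0 <= g n by move=> /HN /=; rewrite subr_ge0.
  have sum_g : \sum_(0 <= j < m.+1) p j * g (m - j)%N =
      (M + eta) * (1 - s m.+1) - f m.+1 + e m.
    rewrite frec -ps opprD addrA subrK mulr_sumr -sumrB.
    by apply: eq_bigr => j _; rewrite /g mulrBr [_ * (M + eta)]mulrC.
  have NmN : (N <= m)%N by rewrite (leq_trans _ Nm)// -addnA leq_addr.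
  have a1 : (0 < m.+1 - N)%N by rewrite subn_gt0 ltnS.
  (* Among the j with m - j >= N, where g >= 0, only j = 0 is kept. At the older indices g >= -2B,
     and their total weight is at most s (m + 1 - N). *)
  have : p 0%N * g m - 2 * B * s (m.+1 - N)%N <= \sum_(0 <= j < m.+1) p j * g (m - j)%N.
    rewrite (big_cat_nat (n := (m.+1 - N)%N)) ?leq_subr//= lerD//.
      rewrite big_ltn// subn0 lerDl big_nat_cond; apply: sumr_ge0 => j.
      rewrite andbT => /andP[_ jm]; rewrite mulr_ge0// gN//; clear - jm; lia.
    apply: (@le_trans _ _ (\sum_(m.+1 - N <= j < m.+1) p j * - (2 * B))); last first.
      by apply: ler_sum => j _; rewrite ler_wpM2l.
    rewrite -mulr_suml mulrN lerN2 [leLHS]mulrC ler_wpM2l ?mulr_ge0//.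
    have := ps m.+1; rewrite (big_cat_nat (n := (m.+1 - N)%N)) ?leq_subr//= ps.
    by have := s_ge0 m.+1; lra.
  rewrite sum_g.
  have s1 := sle m.+1 ltac:(clear - Nm; lia).
  have s2 := sle (m.+1 - N)%N ltac:(clear - Nm; lia).
  have h1 : - ((M + eta) * s m.+1) <= `|M + eta| * (eta / c).
    rewrite (le_trans (ler_norm _))// normrN normrM ler_wpM2l// ger0_norm//.
  have h2 : 2 * B * s (m.+1 - N)%N <= 2 * B * (eta / c) by rewrite ler_wpM2l ?mulr_ge0.
  have h3 : `|M + eta| * (eta / c) + 2 * B * (eta / c) <= eta / 3.
    rewrite -mulrDl mulrA ler_pdivrMr// /c.
    have : 0 <= `|M + eta| + 2 * B by rewrite addr_ge0 ?mulr_ge0.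
    by move: eta0; set q := _ + 2 * B; lra.
  have h4 : 3 * eta <= p 0%N * d.
    by have : eta <= d * p 0%N / 3; [rewrite ge_min lexx orbT|lra].
  rewrite /g => H; have : p 0%N * (M - d) <= p 0%N * f m.
    have : 0 <= p 0%N * eta by rewrite mulr_ge0// ltW.
    lra.
  by rewrite ler_pM2l.
elim=> [|K IH] d N d0.
  have [n Nn fn] := Mfreq d N d0; exists n; rewrite ?addn0// => i.
  by rewrite leqn0 => /eqP ->; rewrite subn0.
have [eta /andP[eta0 etad] [N1 _ HN1]] := step d d0.
have [n Nn fn] := IH eta (N + N1 + 1)%N eta0.
exists n => [|i]; first by lia.
rewrite leq_eqVlt => /predU1P[->|]; last first.
  by rewrite ltnS => /fn; apply: le_trans; rewrite lerD2l lerN2.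
apply: HN1 => /=; first by lia.
have -> : (n - K.+1).+1 = (n - K)%N by lia.
exact: fn.
Qed.

(** Once |y| <= eta, the map x -> (x + eta)/beta contracts towards its fixed point eta/(beta - 1),
    which the choice of [eta] makes equal to d/2. *)
Lemma cvg0_mean (x y : nat -> R) (beta : R) : 1 < beta -> (forall n, 0 <= x n) ->
  (forall n, x n.+1 = (x n + y n) / beta) -> y @ \oo --> 0 -> x @ \oo --> (0 : R).
Proof.
move=> b1 x0 xS y0; apply/cvgr0Pnorm_le => /= d d0.
have b0 : 0 < beta by lra.
have b10 : 0 < beta - 1 by lra.
pose eta := d * (beta - 1) / 2.
have eta0 : 0 < eta by rewrite divr_gt0// mulr_gt0.
have [N _ HN] := cvg0_near y0 eta0.
have xle k : x (N + k)%N <= d / 2 + x N * beta^-1 ^+ k.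
  elim: k => [|k IH]; first by rewrite addn0 expr0 mulr1 lerDr divr_ge0// ltW.
  have := le_trans (ler_norm _) (HN (N + k)%N (leq_addr _ _)) => yk.
  rewrite addnS xS exprSr mulrA ler_pdivrMr// mulrDl divfK ?gt_eqF//.
  by move: yk IH; rewrite /eta; lra.
have : (fun k => x N * beta^-1 ^+ k) @ \oo --> (0 : R).
  rewrite -(mulr0 (x N)); apply: cvgMl_tmp; apply: cvg_expr.
  by rewrite ger0_norm ?invr_ge0 ?ltW// invf_lt1.
have d20 : 0 < d / 2 by rewrite divr_gt0.
move=> /cvg0_near /(_ d20) [N1 _ HN1].
exists (N + N1)%N => // n /= Nn; rewrite ger0_norm//.
have := xle (n - N)%N; rewrite subnKC; last by lia.
move=> /le_trans; apply.
have /= := le_trans (ler_norm _) (HN1 (n - N)%N ltac:(rewrite /=; lia)); lra.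
Qed.

End Renewal.

(** * Asymptotics of the numeration basis *)

Lemma cvg_exprV (R : realType) (beta : R) : 1 < beta ->
  ((fun n => (beta ^+ n)^-1) @ \oo --> (0 : R))%classic.
Proof.
move=> b1; have b0 : 0 < beta by lra.
under eq_fun do rewrite -exprVn.
by apply: cvg_expr; rewrite ger0_norm ?invr_ge0 ?ltW// invf_lt1.
Qed.

Section Asymptotics.
Local Open Scope classical_set_scope.
Variables (R : realType) (beta : R) (t : nat -> nat) (r : nat -> R) (U : nat -> nat).
Hypothesis beta_gt1 : 1 < beta.
Hypothesis rt : quasi_greedy beta t r.
Hypothesis U_rec : forall n, U n = (conv t U n n).+1.

Let beta_gt0 : 0 < beta. Proof. exact: lt_trans beta_gt1. Qed.
Let b10 : 0 < beta - 1. Proof. by rewrite subr_gt0. Qed.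
Let bn_gt0 n : 0 < beta ^+ n. Proof. exact: exprn_gt0. Qed.
Let bn_neq0 n : beta ^+ n != 0. Proof. by rewrite gt_eqF. Qed.
Let r0 : r 0 = 1. Proof. by case: rt. Qed.
Let rS j : r j.+1 = beta * r j - (t j)%:R. Proof. by case: rt. Qed.
Let r_gt0 j : 0 < r j. Proof. by case: rt => _ _ /(_ j)/andP[]. Qed.
Let r_le1 j : r j <= 1. Proof. by case: rt => _ _ /(_ j)/andP[]. Qed.
(** The renewal data: [p] is a probability distribution on the delays, [s n] is its tail from n on,
    and [V] satisfies the renewal equation up to an error beta^-(n+1). *)
Let V n : R := (U n)%:R / beta ^+ n.
Let s n : R := r n / beta ^+ n.
Let p n : R := (t n)%:R / beta ^+ n.+1.
Let binf : R := beta / (beta - 1).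

Let V_ge0 n : 0 <= V n. Proof. by rewrite divr_ge0// ltW. Qed.
Let s_ge0 n : 0 <= s n. Proof. by rewrite divr_ge0// ltW. Qed.
Let p_ge0 n : 0 <= p n. Proof. by rewrite divr_ge0// ltW. Qed.

Let U_recR n : (U n.+1)%:R = \sum_(0 <= j < n.+1) (t j * U (n - j)%N)%:R + 1 :> R.
Proof. by rewrite U_rec /conv -natr1 natr_sum big_mkord. Qed.

Let s_exp n : s n <= (beta ^+ n)^-1.
Proof. by rewrite /s ler_pdivrMr// mulVf ?bn_neq0 ?r_le1. Qed.

(** Inserting r (j+1) = beta * r j - t j at rank n + 1 gives beta times the sum at rank n, while the
    digits cancel the recurrence of [U] except for its constant 1. The sum is thus 1 + beta + ... +
    beta^n. *)
Let sum_U_r n :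
  \sum_(0 <= j < n.+1) (U (n - j)%N)%:R * r j = (beta ^+ n.+1 - 1) / (beta - 1).
Proof.
elim: n => [|n IH].
  by rewrite big_nat1 subn0 r0 mulr1 expr1 divff ?gt_eqF// U_rec /conv big_ord0.
rewrite big_nat_recl// subn0 r0 mulr1.
under eq_bigr => j _ do rewrite subSS rS mulrBr mulrCA.
rewrite sumrB -mulr_sumr IH U_recR.
under [X in _ - X]eq_bigr => j _ do rewrite mulrC -natrM.
by rewrite [beta ^+ n.+2]exprS; field; rewrite gt_eqF.
Qed.

Let sum_V_s n :
  \sum_(0 <= j < n.+1) V (n - j)%N * s j = binf - (beta ^+ n)^-1 / (beta - 1).
Proof.
have -> : \sum_(0 <= j < n.+1) V (n - j)%N * s j =
    (\sum_(0 <= j < n.+1) (U (n - j)%N)%:R * r j) / beta ^+ n.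
  rewrite mulr_suml; apply: eq_big_nat => j /andP[_ jn].
  have -> : beta ^+ n = beta ^+ (n - j) * beta ^+ j by rewrite -exprD subnK.
  by rewrite /V /s; field; rewrite !bn_neq0.
by rewrite sum_U_r exprS /binf; field; rewrite bn_neq0 gt_eqF.
Qed.

Let V_le n : V n <= binf.
Proof.
have : V n * s 0 <= binf.
  apply: (@le_trans _ _ (binf - (beta ^+ n)^-1 / (beta - 1))); last first.
    by rewrite gerBl divr_ge0 ?invr_ge0 ?ltW.
  rewrite -sum_V_s big_ltn// subn0 lerDl big_nat_cond sumr_ge0// => j _.
  by rewrite mulr_ge0.
by rewrite /s r0 expr0 divr1 mulr1.
Qed.

Let sum_p n : \sum_(0 <= j < n) p j = 1 - s n.
Proof.
elim: n => [|n IH]; first by rewrite big_nil /s r0 expr0 divr1 subrr.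
by rewrite big_nat_recr//= IH /s /p rS exprS; field; rewrite bn_neq0 gt_eqF.
Qed.

Let V_rec n : V n.+1 = \sum_(0 <= j < n.+1) p j * V (n - j)%N + (beta ^+ n.+1)^-1.
Proof.
rewrite {1}/V U_recR mulrDl mul1r mulr_suml; congr (_ + _).
apply: eq_big_nat => j /andP[_ jn].
have -> : beta ^+ n.+1 = beta ^+ (n - j) * beta ^+ j.+1 by rewrite -exprD addnS subnK.
by rewrite natrM /p /V; field; rewrite !bn_neq0.
Qed.

Let p0_gt0 : 0 < p 0%N.
Proof. by rewrite /p divr_gt0// ltr0n (t0_gt0 beta_gt1 rt). Qed.

Let s_cvg : s @ \oo --> 0.
Proof.
apply: (squeeze_cvgr _ (cvg_cst (0 : R)) (cvg_exprV beta_gt1)).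
by apply: nearW => n; rewrite s_ge0 s_exp.
Qed.

Let sum_s_tail K n : (K <= n)%N ->
  \sum_(K.+1 <= j < n.+1) s j <= (beta ^+ K)^-1 / (beta - 1).
Proof.
move=> Kn; apply: (@le_trans _ _ (((beta ^+ K)^-1 - (beta ^+ n)^-1) / (beta - 1))).
  rewrite -(subnKC Kn); elim: (n - K)%N => [|m IH].
    by rewrite addn0 big_geq// subrr mul0r.
  rewrite addnS big_nat_recr ?ltnS ?leqW ?leq_addr//=.
  apply: le_trans (lerD IH (s_exp _)) _.
  by rewrite exprS le_eqVlt; apply/orP; left; apply/eqP; field; rewrite bn_neq0 !gt_eqF.
by rewrite ler_pM2r ?invr_gt0// gerBl invr_ge0 ltW.
Qed.

(** Let b and a be the upper and lower limits of V, the latter obtained from -V. Long windows where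
    V is near b, resp. near a, inserted in [sum_V_s] give b * S K <= binf <= a * S K + tau K, where
    [tau] bounds the part of the sum outside the window. As S K >= 1 and tau tends to 0, b <= a; the
    second inequality also yields a > 0. *)
Lemma U_asymptotic : exists2 C : R, 0 < C & (fun n => (U n)%:R / beta ^+ n) @ \oo --> C.
Proof.
have V_norm n : `|V n| <= binf by rewrite ger0_norm.
have e_cvg : (fun n => (beta ^+ n.+1)^-1) @ \oo --> (0 : R).
  by rewrite (cvg_shiftS (fun n => (beta ^+ n)^-1)); exact: cvg_exprV.
have [b Vb Wb] := renewal_limsup V_norm p_ge0 p0_gt0 sum_p s_ge0 s_cvg e_cvg V_rec.
have NV_norm n : `|- V n| <= binf by rewrite normrN.
have Ne_cvg : (fun n => - (beta ^+ n.+1)^-1) @ \oo --> (0 : R).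
  by rewrite -oppr0; exact: cvgN.
have NV_rec n : - V n.+1 = \sum_(0 <= j < n.+1) p j * - V (n - j)%N - (beta ^+ n.+1)^-1.
  by rewrite V_rec opprD -sumrN; congr (_ - _); apply: eq_bigr => j _; rewrite mulrN.
have [a' Va' Wa'] := renewal_limsup NV_norm p_ge0 p0_gt0 sum_p s_ge0 s_cvg Ne_cvg NV_rec.
pose a := - a'; pose S K := \sum_(0 <= j < K.+1) s j.
pose tau K := binf * ((beta ^+ K)^-1 / (beta - 1)).
have S_ge1 K : 1 <= S K.
  rewrite /S big_ltn// {1}/s r0 expr0 divr1 lerDl big_nat_cond.
  by apply: sumr_ge0 => j _.
have bS K : b * S K <= binf.
  apply/ler_addgt0Pr => d d0; pose d' := d / S K.
  have SK0 : 0 < S K by apply: lt_le_trans (S_ge1 K).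
  have d'0 : 0 < d' by rewrite divr_gt0.
  have [n Kn fn] := Wb K _ 0%N d'0; rewrite add0n in Kn.
  rewrite -lerBlDr (_ : b * S K - d = (b - d') * S K); last first.
    by rewrite mulrBl /d' divfK ?gt_eqF.
  apply: (@le_trans _ _ (\sum_(0 <= j < n.+1) V (n - j)%N * s j)); last first.
    by rewrite sum_V_s gerBl divr_ge0 ?invr_ge0 ?ltW.
  rewrite (big_cat_nat (n := K.+1))//= -[leLHS]addr0 lerD//.
    rewrite mulr_sumr; apply: ler_sum_nat => j /andP[_ jK].
    by rewrite ler_wpM2r// fn.
  by rewrite big_nat_cond; apply: sumr_ge0 => j _; rewrite mulr_ge0.
have aS K : binf <= a * S K + tau K.
  apply/ler_addgt0Pr => d d0; pose d' := d / 2 / S K.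
  have SK0 : 0 < S K by apply: lt_le_trans (S_ge1 K).
  have d'0 : 0 < d' by rewrite !divr_gt0.
  have dd0 : 0 < d / 2 * (beta - 1) by rewrite mulr_gt0 ?divr_gt0.
  have [N _ HN] := cvg0_near (cvg_exprV beta_gt1) dd0.
  have [n Kn fn] := Wa' K _ N d'0.
  have nK : (K <= n)%N := leq_trans (leq_addl _ _) Kn.
  have en : (beta ^+ n)^-1 / (beta - 1) <= d / 2.
    rewrite ler_pdivrMr// (le_trans (ler_norm _))//.
    exact: HN (leq_trans (leq_addr _ _) Kn).
  apply: (@le_trans _ _ (\sum_(0 <= j < n.+1) V (n - j)%N * s j + d / 2)).
    by rewrite sum_V_s; lra.
  have -> : a * S K + tau K + d = (a + d') * S K + tau K + d / 2.
    by rewrite mulrDl /d' divfK ?gt_eqF//; lra.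
  rewrite lerD2r (big_cat_nat (n := K.+1))//= lerD//.
    rewrite mulr_sumr; apply: ler_sum_nat => j /andP[_ jK]; rewrite ler_wpM2r//.
    by have := fn j jK; rewrite /a; lra.
  apply: (@le_trans _ _ (\sum_(K.+1 <= j < n.+1) binf * s j)).
    by apply: ler_sum => j _; rewrite ler_wpM2r.
  by rewrite -mulr_sumr ler_wpM2l ?sum_s_tail// divr_ge0 ?ltW.
have tau0 : tau @ \oo --> 0.
  rewrite -(mulr0 binf); apply: cvgMl_tmp; rewrite -(mul0r (beta - 1)^-1).
  by apply: cvgMr_tmp; exact: cvg_exprV.
have a0 : 0 < a.
  have [N _ HN] := cvg0_near tau0 (ltac:(lra) : 0 < 2^-1 :> R).
  have := le_trans (ler_norm _) (HN N (leqnn N)); have := aS N => h1 h2.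
  have : 1 <= binf by rewrite /binf ler_pdivlMr// mul1r gerBl.
  move=> h3; have : 0 < a * S N by move: h1 h2 h3 => /=; lra.
  by rewrite pmulr_lgt0//; apply: lt_le_trans (S_ge1 N).
have ba : b <= a.
  apply/ler_addgt0Pr => d d0; have [N _ HN] := cvg0_near tau0 d0.
  have h1 := le_trans (ler_norm _) (HN N (leqnn N)).
  have := le_trans (bS N) (aS N) => h2; rewrite -lerBlDl.
  have [h3|h3] := leP (b - a) 0; first exact: le_trans h3 (ltW d0).
  apply: le_trans h1; apply: (@le_trans _ _ ((b - a) * S N)); last by lra.
  by rewrite ler_peMr// ltW.
exists a => //; apply/cvgrPdist_le => /= d d0.
apply: filterS (filterI (Vb d d0) (Va' d d0)) => n [h1 h2].
by rewrite ler_distlC; move: h1 h2 ba; rewrite /V /a; lra.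
Qed.

Lemma val_word_sub (C : R) (D : nat) w : all (fun a => a <= D)%N w ->
  `|(val_word U w)%:R - C * (frac_word beta w * beta ^+ size w)| <=
  D%:R * \sum_(0 <= j < size w) `|(U j)%:R - C * beta ^+ j|.
Proof.
elim: w => [_|a w IH /= /andP[aD wD]].
  by rewrite val_word_nil frac_word_nil mul0r mulr0 subrr normr0 big_nil mulr0.
rewrite val_word_cons natrD natrM frac_word_cons big_nat_recr//= mulrDr.
have -> : a%:R * (U (size w))%:R + (val_word U w)%:R -
    C * ((a%:R + frac_word beta w) / beta * beta ^+ (size w).+1) =
    ((val_word U w)%:R - C * (frac_word beta w * beta ^+ size w)) +
    a%:R * ((U (size w))%:R - C * beta ^+ size w).
  by rewrite exprS; field; rewrite gt_eqF.
rewrite (le_trans (ler_normD _ _))// lerD ?IH// normrM ler_wpM2r//.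
by rewrite normr_nat ler_nat.
Qed.

(** The errors |U j - C beta^j| add up over the digits, and their sum up to n is still negligible
    against beta^n by [cvg0_mean]. The threshold depends on D and e only: it must serve all the
    words of length at most n at once. *)
Lemma val_word_frac (D : nat) (e : R) : 0 < e ->
  \forall n \near \oo, forall w, (size w <= n)%N -> all (fun a => a <= D)%N w ->
    frac_word beta w <= 1 ->
    `|(val_word U w)%:R / (U n)%:R - frac_word beta w / beta ^+ (n - size w)| <= e.
Proof.
move=> e0; have [C C0 UC] := U_asymptotic.
pose x n : R := (\sum_(0 <= j < n) `|(U j)%:R - C * beta ^+ j|) / beta ^+ n.
have x_cvg : x @ \oo --> (0 : R).
  apply: (@cvg0_mean _ x (fun n => `|V n - C|) beta) => //.
  - by move=> n; apply: divr_ge0; [exact: sumr_ge0|exact: ltW].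
  - move=> n; rewrite /x big_nat_recr//= exprSr invfM mulrA; congr (_ / _).
    have -> : V n - C = ((U n)%:R - C * beta ^+ n) / beta ^+ n by rewrite mulrBl mulfK.
    by rewrite mulrDl normrM (normfV (beta ^+ n)) (gtr0_norm (bn_gt0 n)).
  - apply/cvgr0Pnorm_le => d d0; have /cvgrPdist_le /(_ _ d0) := UC.
    by apply: filterS => n; rewrite normr_id distrC.
pose K : R := D%:R + 1.
have K0 : 0 < K by rewrite /K ltr_wpDl.
(* Two errors of at most eC/4, one from the digits and one from replacing V n by C, are finally
   divided by V n >= C/2. *)
have eta0 : 0 < e * C / 4 / K by rewrite !(divr_gt0, mulr_gt0).
have eta1 : 0 < e * C / 4 by rewrite divr_gt0// mulr_gt0.
have C20 : 0 < C / 2 by rewrite divr_gt0.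
have h1 := cvg0_near x_cvg eta0.
have /cvgrPdist_le /(_ _ eta1) h2 := UC.
have /cvgrPdist_le /(_ _ C20) h3 := UC.
apply: filterS (filterI h1 (filterI h2 h3)) => n [xn [Vn1 Vn2]] w wn wD fw.
set F := _ / beta ^+ (n - size w).
have F01 : 0 <= F <= 1.
  rewrite divr_ge0 ?frac_word_ge0 ?(ltW (bn_gt0 _))//= ler_pdivrMr// mul1r.
  by rewrite (le_trans fw)// exprn_ege1// ltW.
have Vn : C / 2 <= V n by move: Vn2; rewrite -/(V n) ler_norml; lra.
have Vn0 : 0 < V n by apply: lt_le_trans Vn.
have dist : `|(val_word U w)%:R / beta ^+ n - C * F| <= e * C / 4.
  have -> : (val_word U w)%:R / beta ^+ n - C * F =
      ((val_word U w)%:R - C * (frac_word beta w * beta ^+ size w)) / beta ^+ n.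
    have -> : beta ^+ n = beta ^+ (n - size w) * beta ^+ size w by rewrite -exprD subnK.
    by rewrite /F; field; rewrite !bn_neq0.
  rewrite normrM (normfV (beta ^+ n)) (gtr0_norm (bn_gt0 _)) ler_pdivrMr//.
  have := val_word_sub C wD => /le_trans; apply.
  have : x n <= e * C / 4 / K := le_trans (ler_norm _) xn.
  rewrite /x ler_pdivrMr// => xn'.
  apply: (@le_trans _ _ (K * (e * C / 4 / K * beta ^+ n))); last first.
    by rewrite mulrA [K * _]mulrC divfK ?gt_eqF.
  apply: ler_pM; rewrite ?ler0n ?sumr_ge0// ?lerDl//; apply: le_trans xn'.
  by rewrite [leRHS](big_cat_nat (n := size w))//= lerDl sumr_ge0.
have -> : (val_word U w)%:R / (U n)%:R - F =
    (((val_word U w)%:R / beta ^+ n - C * F) + (C - V n) * F) / V n.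
  have U0 : (U n)%:R != 0 :> R.
    by apply: contraTneq Vn0 => U0; rewrite /V U0 mul0r ltxx.
  by rewrite /V; field; rewrite U0 bn_neq0.
rewrite normrM [X in _ * X]normfV (gtr0_norm Vn0) ler_pdivrMr//.
apply: le_trans (ler_normD _ _) _; rewrite normrM [`|F|]ger0_norm; last by case/andP: F01.
have : `|C - V n| * F <= e * C / 4.
  by rewrite -[leRHS]mulr1 ler_pM//; case/andP: F01.
have : e * (C / 2) <= e * V n by rewrite ler_wpM2l// ltW.
by move: dist; lra.
Qed.

End Asymptotics.

(** * From greedy to quasi-greedy expansions *)

Section GreedyExpansion.
Local Open Scope classical_set_scope.
Variables (R : realType) (beta : R).
Hypothesis beta_gt1 : 1 < beta.
Let beta_gt0 : 0 < beta. Proof. exact: lt_trans beta_gt1. Qed.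
Let bn_neq0 n : beta ^+ n != 0. Proof. by rewrite gt_eqF// exprn_gt0. Qed.

Lemma ceil_beta_itv : (ceil_beta beta).-1%:R < beta <= (ceil_beta beta)%:R.
Proof.
have c0 : (0 < ceil_beta beta)%N by rewrite absz_gt0 gt_eqF// ceil_gt0.
have cE : (ceil_beta beta)%:R = (Num.ceil beta)%:~R :> R.
  by rewrite natr_absz gtr0_norm// ceil_gt0.
by have := ceil_itv beta; rewrite intrB rmorph1 -cE -subn1 natrB.
Qed.

Lemma ceil_betaE n : n%:R < beta <= n.+1%:R -> ceil_beta beta = n.+1.
Proof.
move=> nb; rewrite /ceil_beta (_ : Num.ceil beta = n.+1)//.
apply: ceil_def; have -> : n.+1%:Z - 1 = n by rewrite -addn1 PoszD addrK.
exact: nb.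
Qed.

Section Remainders.
Variables (x : R) (c : nat -> nat) (g : nat -> R).
Hypothesis g0 : g 0 = x.
Hypothesis gS : forall j, g j.+1 = beta * g j - (c j)%:R.

Lemma partial_expansion n : \sum_(0 <= i < n) (c i)%:R * beta ^- i.+1 = x - g n / beta ^+ n.
Proof.
elim: n => [|n IH]; first by rewrite big_nil g0 expr0 divr1 subrr.
rewrite big_nat_recr//= IH gS exprS; field.
by rewrite bn_neq0 gt_eqF.
Qed.

Hypothesis g_itv : forall j, 0 <= g j < 1.

Lemma expansion_cvg j :
  (fun n => \sum_(j <= i < n) (c i)%:R * beta ^- i.+1) @ \oo --> g j / beta ^+ j.
Proof.
have g_cvg : (fun n => g n / beta ^+ n) @ \oo --> (0 : R).
  apply: (squeeze_cvgr _ (cvg_cst (0 : R)) (cvg_exprV beta_gt1)).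
  apply: nearW => n; have /andP[gn0 /ltW gn1] := g_itv n.
  rewrite divr_ge0 ?exprn_ge0 ?(ltW beta_gt0)//= -[leRHS]mul1r ler_wpM2r//.
  by rewrite invr_ge0 exprn_ge0// ltW.
have : (fun n => g j / beta ^+ j - g n / beta ^+ n) @ \oo --> g j / beta ^+ j - 0.
  by apply: cvgB => //; exact: cvg_cst.
rewrite subr0; apply: cvg_trans; apply: near_eq_cvg; exists j => // n /= jn.
have := partial_expansion n; rewrite (big_cat_nat (n := j))//= partial_expansion.
by move=> h; lra.
Qed.

Lemma remainders_greedy : (forall j, (c j < ceil_beta beta)%N) -> is_greedy_expansion beta x c.
Proof.
move=> cb; split=> // [|j].
  by have := @expansion_cvg 0%N; rewrite g0 expr0 divr1.
rewrite (cvg_lim _ (@expansion_cvg j))//.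
by rewrite ltr_pdivrMr ?exprn_gt0// mulVf//; case/andP: (g_itv j).
Qed.

End Remainders.

Lemma greedy_expansion_exists x : 0 <= x < 1 -> exists c, is_greedy_expansion beta x c.
Proof.
move=> x01; pose T y : R := beta * y - (Num.trunc (beta * y))%:R.
pose g j := iter j T x.
have g_itv j : 0 <= g j < 1.
  elim: j => [//|j /andP[gj0 _]]; rewrite /g /= -/(g j) /T.
  have := truncn_itv (mulr_ge0 (ltW beta_gt0) gj0).
  by rewrite -natr1; lra.
exists (fun j => Num.trunc (beta * g j)).
apply: (@remainders_greedy x _ g) => // j.
rewrite -(ltr_nat R); have /andP[_] := ceil_beta_itv; apply: lt_le_trans.
have /andP[gj0 gj1] := g_itv j.
have /andP[h _] := truncn_itv (mulr_ge0 (ltW beta_gt0) gj0).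
by apply: le_lt_trans h _; rewrite gtr_pMr.
Qed.

(** The remainder is beta^j times x minus the j-th partial sum, and the clause on tails in the
    greedy condition says precisely that it is below 1. *)
Lemma greedy_remainders x c : 0 <= x < 1 -> is_greedy_expansion beta x c ->
  exists g : nat -> R, [/\ g 0 = x, forall j, g j.+1 = beta * g j - (c j)%:R
                         & forall j, 0 <= g j < 1].
Proof.
move=> x01 [_ c_cvg c_tail].
pose S n : R := \sum_(0 <= i < n) (c i)%:R * beta ^- i.+1.
exists (fun j => beta ^+ j * (x - S j)); split=> [|j|j].
- by rewrite /S big_nil subr0 expr0 mul1r.
- rewrite /S big_nat_recr//= exprS; field.
  by rewrite bn_neq0 gt_eqF.
have tail_cvg : (fun n => \sum_(j <= i < n) (c i)%:R * beta ^- i.+1) @ \oo --> x - S j.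
  have : (fun n => S n - S j) @ \oo --> x - S j by apply: cvgB => //; exact: cvg_cst.
  apply: cvg_trans; apply: near_eq_cvg; exists j => // n /= jn.
  by rewrite /S (big_cat_nat (n := j))//= addrAC subrr add0r.
have tail_ge0 : 0 <= x - S j.
  apply: (cvgr_to_ge tail_cvg); apply: nearW => n; apply: sumr_ge0 => i _.
  by rewrite mulr_ge0// invr_ge0 exprn_ge0// ltW.
rewrite mulr_ge0 ?exprn_ge0 ?(ltW beta_gt0)//=.
by have := c_tail j; rewrite (cvg_lim _ tail_cvg)// -[_ ^- j]mul1r ltr_pdivlMr ?exprn_gt0// mulrC.
Qed.

Lemma expansion1_0 : expansion1 beta 0 = (ceil_beta beta).-1.
Proof. by rewrite /expansion1; case: ifP. Qed.

(** For beta not an integer, the remainder 1 is put in front of those of beta - (ceil beta - 1).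
    Both ends of [0,1] occur: 1 at the start, and 0 when the expansion is finite. *)
Lemma expansion1_remainders : exists g : nat -> R,
  [/\ g 0 = 1, forall j, g j.+1 = beta * g j - (expansion1 beta j)%:R
     & forall j, 0 <= g j <= 1].
Proof.
rewrite /expansion1; case: ifPn => [/natrP[k bE]|bN].
  have k0 : (0 < k)%N by rewrite -(ltr_nat R) -bE.
  exists (fun=> 1); split=> // [_|_]; last by rewrite ler01 lexx.
  have -> : ceil_beta beta = k.
    by rewrite -(prednK k0); apply: ceil_betaE; rewrite prednK// -bE lexx andbT bE ltr_nat ltn_predL.
  by rewrite mulr1 -subn1 natrB// -bE; lra.
have /andP[cb bc] := ceil_beta_itv.
have c0 : (0 < ceil_beta beta)%N by rewrite -(ltr_nat R) (lt_le_trans beta_gt0).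
have bc' : beta < (ceil_beta beta)%:R.
  by rewrite lt_neqAle bc andbT; apply: contraNneq bN => ->; apply: natr_nat.
set x := beta * _; have xE : x = beta - (ceil_beta beta).-1%:R.
  by rewrite /x; field; rewrite gt_eqF.
have x01 : 0 <= x < 1.
  by rewrite xE; move: cb bc'; rewrite -[ceil_beta beta]prednK//= -natr1; lra.
have [g [g0 gS g01]] := greedy_remainders x01 (getPex (greedy_expansion_exists x01)).
exists (fun j => if j is j'.+1 then g j' else 1); split=> // [[|j]|[|j]].
- by rewrite g0 xE mulr1.
- by rewrite gS.
- by rewrite ler01 lexx.
- by have /andP[-> /ltW] := g01 j.
Qed.

End GreedyExpansion.

(** * Quasi-greedy remainders obtained from greedy ones *)

Section QuasiGreedyOfGreedy.
Variables (R : realType) (beta : R) (d : nat -> nat) (g : nat -> R).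
Hypothesis beta_gt1 : 1 < beta.
Hypothesis g0 : g 0 = 1.
Hypothesis gS : forall j, g j.+1 = beta * g j - (d j)%:R.
Hypothesis g01 : forall j, 0 <= g j <= 1.
Let beta_gt0 : 0 < beta. Proof. exact: lt_trans beta_gt1. Qed.

Lemma remainder0_stop m k : g m = 0 -> d (m + k)%N = 0%N /\ g (m + k)%N = 0.
Proof.
move=> gm; have gk0 : g (m + k)%N = 0.
  elim: k => [|k IH]; first by rewrite addn0.
  have := gS (m + k); rewrite -addnS IH mulr0 sub0r => gE.
  have /andP[] := g01 (m + k.+1); rewrite gE oppr_ge0 => dk _.
  by apply/eqP; rewrite oppr_eq0 eq_le dk ler0n.
split=> //; have := gS (m + k); rewrite gk0 mulr0 sub0r => gE.
have /andP[] := g01 (m + k).+1; rewrite gE oppr_ge0 => dk _.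
by apply/eqP; rewrite -leqn0 -(ler_nat R).
Qed.

(** From m on, each step multiplies the remainder by beta, yet it never exceeds 1; so it is zero. *)
Lemma finite_expansion_stop m : finite_expansion d m -> g m = 0.
Proof.
move=> [_ [_ dm]]; apply/eqP; rewrite eq_le; have /andP[-> _] := g01 m; rewrite andbT.
have gk k : g (m + k)%N = beta ^+ k * g m.
  elim: k => [|k IH]; first by rewrite addn0 expr0 mul1r.
  by rewrite addnS gS dm ?leq_addr// subr0 IH exprS mulrA.
rewrite leNgt; apply/negP => gm0.
have [N _ HN] := cvg0_near (cvg_exprV beta_gt1) (divr_gt0 gm0 (ltr0Sn _ 1)).
have := le_trans (ler_norm _) (HN N (leqnn N)).
have := g01 (m + N); rewrite gk => /andP[_].
have bN0 : 0 < beta ^+ N by rewrite exprn_gt0.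
rewrite mulrC -ler_pdivlMr// mul1r; lra.
Qed.

Lemma finite_expansion_gt0 m k : finite_expansion d m -> (k < m)%N -> 0 < g k.
Proof.
move=> fm km; have [m0 [dm _]] := fm.
have gE j : g j = ((d j)%:R + g j.+1) / beta.
  by rewrite gS addrCA subrr addr0 mulrAC mulfV ?mul1r// gt_eqF.
have gm1 : 0 < g m.-1.
  rewrite gE prednK// (finite_expansion_stop fm) addr0 divr_gt0// ltr0n lt0n.
  exact/eqP.
(* Descending induction from m - 1, where the nonzero digit makes the remainder positive; truncated
   subtraction makes the steps past 0 trivial. *)
have : forall j, 0 < g (m.-1 - j)%N.
  elim=> [|j IH]; first by rewrite subn0.
  have [jm|mj] := ltnP j m.-1; last first.
    by have -> : (m.-1 - j.+1 = m.-1 - j)%N by lia.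
  rewrite gE divr_gt0// ltr_wpDl//.
  by have -> : ((m.-1 - j.+1).+1 = m.-1 - j)%N by lia.
by move=> /(_ (m.-1 - k)%N); have -> : (m.-1 - (m.-1 - k) = k)%N by lia.
Qed.

(** A zero remainder at j leaves only zero digits from j on. The least n from which all digits
    vanish is then the length of a finite expansion, nonzero because d 0 > 0. *)
Lemma quasi_greedy_infinite : (0 < d 0)%N -> (~ exists m, finite_expansion d m) ->
  quasi_greedy beta d g.
Proof.
move=> d0 Nd; split=> // j; have /andP[gj0 ->] := g01 j; rewrite andbT.
rewrite lt_neqAle gj0 andbT; apply: contra_notN Nd => /eqP/esym gj.
have ex : exists n, [forall i : 'I_j, (n <= i)%N ==> (d i == 0%N)].
  by exists j; apply/forallP => i; apply/implyP; rewrite leqNgt ltn_ord.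
have [n /forallP nP nmin] := ex_minnP ex.
have dn i : (n <= i)%N -> d i = 0%N.
  move=> ni; have [ij|ji] := ltnP i j; first by apply/eqP; exact: (implyP (nP (Ordinal ij))).
  by rewrite -(subnKC ji); case: (remainder0_stop (i - j) gj).
have n0 : (0 < n)%N by rewrite lt0n; apply/eqP => n0; move: d0; rewrite dn// n0.
exists n; split=> //; split=> // dn1.
suff /nmin : [forall i : 'I_j, (n.-1 <= i)%N ==> (d i == 0%N)] by rewrite leqNgt ltn_predL n0.
apply/forallP => i; apply/implyP; rewrite leq_eqVlt => /predU1P[<-|]; first exact/eqP.
by rewrite prednK// => /dn ->.
Qed.

(** This is d^*_beta(1) when d_beta(1) has length m. Lowering the last digit by one turns the final
    remainder 0 into 1, so the remainders restart with period m. *)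
Definition periodize (m i : nat) : nat :=
  if (i %% m == m.-1)%N then (d (i %% m)).-1 else d (i %% m).

Lemma quasi_greedy_finite m : finite_expansion d m ->
  quasi_greedy beta (periodize m) (fun i => g (i %% m)).
Proof.
move=> fm; have [m0 [dm _]] := fm; split=> [|j|j]; first by rewrite mod0n.
  rewrite /periodize -addn1 -modnDml addn1; set k := (j %% m)%N.
  have km : (k < m)%N by rewrite ltn_mod.
  have [kE|kN] := eqVneq k m.-1.
    have dE : ((d m.-1).-1.+1)%:R = (d m.-1)%:R :> R by rewrite prednK// lt0n; apply/eqP.
    rewrite kE prednK// modnn g0; have := gS m.-1; move: dE.
    by rewrite -natr1 (prednK m0) (finite_expansion_stop fm); lra.
  by rewrite modn_small ?gS//; move/eqP: kN; lia.
have /andP[_ ->] := g01 (j %% m); rewrite andbT.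
by apply: (finite_expansion_gt0 fm); rewrite ltn_mod.
Qed.

End QuasiGreedyOfGreedy.

(** * The recurrences defining U and their common form *)

Section Recurrence.
Local Open Scope nat_scope.
Implicit Types (t d U V : nat -> nat).

Lemma U_rec_exists t : exists U, forall n, U n = (conv t U n n).+1.
Proof.
(* Course-of-values recursion: [rows n] lists U(n-1), ..., U(0), latest value first. *)
pose rows := fix rows n := if n is n'.+1
  then (\sum_(j < n') t j * nth 0 (rows n') j).+1 :: rows n' else [::].
have nth_rows n j : j < n -> nth 0 (rows n) j = head 0 (rows (n - j)).
  by elim: n j => // n IH [|j] jn //; rewrite subSS -IH.
exists (fun n => head 0 (rows n.+1)) => n /=; congr _.+1; apply: eq_bigr => j _.
by rewrite nth_rows// -(subnSK (ltn_ord j)).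
Qed.

(** The least preperiod m0 and the least period k0 come from possibly different pairs (m0,k1) and
    (m1,k0). A shift by m1 periods k1 moves any index i >= m0 beyond m1, where k0 is a period, so
    (m0,k0) works too. *)
Lemma minimal_periodic_exists d : (exists m k, periodic_expansion d m k) ->
  exists m k, minimal_periodic_expansion d m k.
Proof.
move=> [m [k mk]].
pose M m := exists k, periodic_expansion d m k.
pose K k := exists m, periodic_expansion d m k.
have exM : exists m, `[< M m >] by exists m; apply/asboolP; exists k.
have exK : exists k, `[< K k >] by exists k; apply/asboolP; exists m.
have [m0 /asboolP[k1 [k1_gt0 m0k1]] m0_min] := ex_minnP exM.
have [k0 /asboolP[m1 [k0_gt0 m1k0]] k0_min] := ex_minnP exK.
exists m0, k0; split=> [|m' k' mk']; last first.
  by split; [apply: m0_min|apply: k0_min]; apply/asboolP; [exists k'|exists m'].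
split=> // i m0i.
have shift N j : m0 <= j -> d (j + N * k1) = d j.
  move=> mj; elim: N => [|N IH]; first by rewrite addn0.
  by rewrite mulSnr addnA m0k1// (leq_trans mj)// leq_addr.
rewrite -(shift m1 (i + k0)) ?(leq_trans m0i) ?leq_addr// addnAC m1k0 ?shift//.
by rewrite (leq_trans _ (leq_addl _ _))// leq_pmulr.
Qed.

Lemma is_U_unique d U V : (exists m k, periodic_expansion d m k) ->
  is_U d U -> is_U d V -> U = V.
Proof.
move=> per [Uf Up] [Vf Vp].
have conv_eq l k n : (forall i, i < n -> U i = V i) -> k <= n -> 0 < k ->
    conv d U l k = conv d V l k.
  by move=> UV kn k0; apply: eq_bigr => j _; rewrite UV//; lia.
suff UV n : (forall i, i < n -> U i = V i) -> U n = V n.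
  by apply/funext => n; elim/ltn_ind: n => n IH; exact: UV.
move=> UV; have [fin|inf] := pselect (exists m, finite_expansion d m).
  have [m fm] := fin; have [m0 _] := fm.
  have [[U0 Ui] Um] := Uf m fm; have [[V0 Vi] Vm] := Vf m fm.
  have [->|n0] := posnP n; first by rewrite U0 V0.
  have [nm|mn] := ltnP n m; last by rewrite Um// Vm//; exact: (conv_eq _ _ n UV).
  by rewrite Ui ?n0// Vi ?n0//; congr (_ + _); exact: (conv_eq _ _ n UV).
have [m [k mk]] := minimal_periodic_exists per; have [[k0 _] _] := mk.
have [[U0 Ui] Um] := Up inf m k mk; have [[V0 Vi] Vm] := Vp inf m k mk.
have [->|n0] := posnP n; first by rewrite U0 V0.
have [nm|mn] := ltnP n (m + k).
  by rewrite Ui ?n0// Vi ?n0//; congr (_ + _); exact: (conv_eq _ _ n UV).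
have := Um n mn; rewrite (conv_eq _ _ n UV)// (UV (n - k)); last by lia.
have -> : conv d U m (n - k) = conv d V m (n - k).
  have [nk0|nk0] := posnP (n - k); last by apply: (conv_eq _ _ n) => //; lia.
  have -> : m = 0 by lia.
  by rewrite /conv !big_ord0.
by rewrite -Vm// => -[].
Qed.

Lemma conv_split t U l n : l <= n ->
  conv t U n n = conv t U l n + \sum_(j < n - l) t (l + j) * U (n - l - j.+1).
Proof.
move=> ln; have [k ->] : exists k, n = l + k by exists (n - l); rewrite subnKC.
rewrite /conv big_split_ord/= addKn; congr (_ + _).
by apply: eq_bigr => j _; rewrite -addnS subnDl.
Qed.

(** Past its first m terms, the convolution at n is by periodicity the one at n - m; with the
    constant 1 it makes U(n - m), exactly the unit removed from t_m by [periodize]. *)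
Lemma is_U_finite d m U : finite_expansion d m ->
  (forall n, U n = (conv (periodize d m) U n n).+1) -> is_U d U.
Proof.
move=> fm Urec; have [m0 [dm dm0]] := fm; split=> [m' [m'0 [dm' dm'0]]|[]]; last by exists m.
have -> : m' = m.
  have [lt|lt|//] := ltngtP m' m.
    by case: dm; rewrite dm'0//; lia.
  by case: dm'; rewrite dm0//; lia.
have conv_d n l : l < m -> conv (periodize d m) U l n = conv d U l n.
  move=> lm; apply: eq_bigr => -[j jl] _ /=; rewrite /periodize modn_small; last by lia.
  by case: eqP => //; lia.
split=> [|n mn].
  by split=> [|i /andP[i0 im]]; rewrite Urec ?conv_d ?addn1// /conv big_ord0.
rewrite Urec (conv_split _ _ mn).
have -> : \sum_(j < n - m) periodize d m (m + j) * U (n - m - j.+1) =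
    conv (periodize d m) U (n - m) (n - m).
  by apply: eq_bigr => j _; rewrite /periodize modnDl.
rewrite -addnS -Urec /conv -(prednK m0) !big_ord_recr/= (prednK m0).
have -> : \sum_(i < m.-1) periodize d m i * U (n - i.+1) = conv d U m.-1 n.
  by rewrite -conv_d// ltn_predL.
rewrite {1}/periodize modn_small ?ltn_predL// eqxx /conv -addnA -mulSnr prednK// lt0n.
exact/eqP.
Qed.

(** Subtracting the recurrences at n and n - k cancels the constants and, by periodicity, all terms
    beyond the first m + k, resp. m. [H] states this additively to stay within natural numbers. *)
Lemma is_U_periodic d U : (~ exists m, finite_expansion d m) ->
  (forall n, U n = (conv d U n n).+1) -> is_U d U.
Proof.
move=> Nf Urec; split=> [m fm|_ m k [[k0 dmk] _]]; first by case: Nf; exists m.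
split=> [|n mkn].
  by split=> [|i _]; rewrite Urec ?addn1// /conv big_ord0.
have H : U n + conv d U m (n - k) = conv d U (m + k) n + U (n - k).
  have mnk : m <= n - k by lia.
  rewrite Urec (conv_split _ _ mkn) [U (n - k)]Urec (conv_split _ _ mnk).
  have -> : \sum_(j < n - k - m) d (m + j) * U (n - k - m - j.+1) =
      \sum_(j < n - (m + k)) d (m + k + j) * U (n - (m + k) - j.+1).
    have -> : n - (m + k) = n - k - m by lia.
    by apply: eq_bigr => j _; rewrite addnAC dmk ?leq_addr.
  lia.
by rewrite -PoszD -H PoszD addrK.
Qed.

End Recurrence.

(** [Ubeta] is a chosen solution of [is_U]; the single recurrence has a solution, which satisfies
    [is_U], and uniqueness identifies the two. The ceiling comes from r 1 = beta - t 0 in (0,1]. *)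
Lemma Ubeta_quasi_greedy (R : realType) (beta : R) : 1 < beta -> parry beta ->
  exists t r, [/\ quasi_greedy beta t r,
    forall n, Ubeta beta n = (conv t (Ubeta beta) n n).+1 & ceil_beta beta = (t 0).+1].
Proof.
move=> b1 per; set d := expansion1 beta in per *.
have [g [g0 gS g01]] := expansion1_remainders b1.
have d0 : (0 < d 0)%N.
  have : (1 < ceil_beta beta)%N.
    by have /andP[_] := ceil_beta_itv b1; rewrite -(ltr_nat R); exact: lt_le_trans.
  by rewrite /d expansion1_0; case: (ceil_beta beta) => [|[]].
suff [t [r [rt Ut]]] : exists t r, quasi_greedy beta t r /\
    forall U, (forall n, U n = (conv t U n n).+1) -> is_U d U.
  have [U Urec] := U_rec_exists t; have dU := Ut U Urec.
  have UE : Ubeta beta = U by apply: (is_U_unique per (getPex (ex_intro _ U dU)) dU).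
  exists t, r; split=> //; first by rewrite UE.
  have [r0 rS r01] := rt; apply: ceil_betaE; rewrite -natr1.
  by have := r01 1%N; rewrite rS r0; lra.
have [[m fm]|Nf] := pselect (exists m, finite_expansion d m).
  exists (periodize d m), (fun i => g (i %% m)%N); split.
    exact: (quasi_greedy_finite b1).
  by move=> U; exact: is_U_finite.
exists d, g; split; first exact: quasi_greedy_infinite.
by move=> U; exact: is_U_periodic.
Qed.

(** * The language of the numeration system *)

Section Language.
Local Open Scope classical_set_scope.
Variables (R : realType) (beta : R) (t : nat -> nat) (r : nat -> R) (U : nat -> nat).
Hypothesis beta_gt1 : 1 < beta.
Hypothesis rt : quasi_greedy beta t r.
Hypothesis U_rec : forall n, U n = (conv t U n n).+1.
Implicit Types (u v w x : seq nat).

Let beta_gt0 : 0 < beta. Proof. exact: lt_trans beta_gt1. Qed.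
Let beta_neq0 : beta != 0. Proof. by rewrite gt_eqF. Qed.
Let U0 : U 0 = 1%N. Proof. exact: quasi_greedy_U0 U_rec. Qed.
Let U_incr n : (U n < U n.+1)%N. Proof. exact: U_ltn beta_gt1 rt U_rec n. Qed.
Let frac_lt1 w : greedy U w -> frac_word beta w < 1.
Proof. exact: frac_word_lt1 beta_gt1 rt U_rec w. Qed.
Let digits w : greedy U w -> all (fun a => a <= t 0)%N w.
Proof. exact: greedy_digits beta_gt1 rt U_rec w. Qed.

Lemma invU_near (e : R) : 0 < e -> \forall n \near \oo, (U n)%:R^-1 <= e.
Proof.
move=> e0; have ie0 : 0 <= e^-1 by rewrite invr_ge0 ltW.
exists (Num.trunc e^-1) => // n /= en; have /andP[_ e1] := truncn_itv ie0.
have Un : e^-1 <= (U n)%:R.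
  rewrite (le_trans (ltW e1))// ler_nat (leq_trans _ (U_gtn U0 U_incr n))//.
by rewrite -[leRHS]invrK lef_pV2// posrE ?invr_gt0// (lt_le_trans _ Un)// invr_gt0.
Qed.

(** The gap 1 - 0.u is cut into three: one third for the suffix, which weighs at most beta^-p, one
    third for the error of [val_word_frac], and one third that keeps the inequality strict. *)
Lemma val_glue_near u : all (fun a => a <= t 0)%N u -> frac_word beta u < 1 ->
  \forall p \near \oo, forall x, greedy U x ->
    (val_word U (u ++ zeros p ++ x) < U (size (u ++ zeros p ++ x)))%N.
Proof.
move=> du u1; pose e := (1 - frac_word beta u) / 3.
have e0 : 0 < e by rewrite divr_gt0// subr_gt0.
have [N _ HN] := val_word_frac beta_gt1 rt U_rec (t 0) e0.
have h2 := cvg0_near (cvg_exprV beta_gt1) e0.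
near=> p => x gx; set w := u ++ _.
have Nw : (N <= size w)%N.
  rewrite !size_cat size_nseq addnCA (leq_trans _ (leq_addr _ _))//.
  by near: p; exists N.
have dw : all (fun a => a <= t 0)%N w.
  by rewrite !all_cat du /zeros all_nseq orbT digits.
have bp : (beta ^+ p)^-1 <= e.
  by rewrite (le_trans (ler_norm _))//; near: p; exact: h2.
have fx : frac_word beta x / beta ^+ p <= (beta ^+ p)^-1.
  by rewrite ler_piMl ?invr_ge0 ?exprn_ge0 ?(ltW beta_gt0)// ltW// frac_lt1.
have fw : frac_word beta w <= frac_word beta u + e.
  rewrite /w frac_word_cat// frac_word_cat// frac_word_zeros// add0r size_nseq lerD2l.
  apply: le_trans (le_trans fx bp); rewrite ler_piMr ?invf_le1 ?exprn_gt0//.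
    by rewrite divr_ge0 ?frac_word_ge0// exprn_ge0// ltW.
  by rewrite exprn_ege1// ltW.
have fw1 : frac_word beta w <= 1 by move: fw e0; rewrite /e; lra.
have := HN (size w) Nw w (leqnn _) dw fw1.
have U_gt0 : 0 < (U (size w))%:R :> R by rewrite ltr0n (U_gt0 U0 U_incr).
rewrite subnn expr0 divr1 ler_norml => /andP[_ h].
rewrite -(ltr_nat R) -[ltRHS]mul1r -ltr_pdivrMr//.
by move: h fw e0; rewrite /e; lra.
Unshelve. all: by end_near. Qed.

(** [val_glue_near] applied to each of the finitely many nonempty suffixes of [u]; this is what
    makes p(u,v) exist. *)
Lemma greedy_glue_near u : greedy U u ->
  \forall p \near \oo, forall x, greedy U x -> greedy U (u ++ zeros p ++ x).
Proof.
elim: u => [_|a u IH gau].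
  by apply: nearW => p x gx; rewrite /= greedy_zeros.
have h := val_glue_near (digits gau) (frac_lt1 gau).
have gu : greedy U u by case/andP: gau.
apply: filterS (filterI h (IH gu)) => p [h1 h2] x gx.
by rewrite cat_cons /= -cat_cons h1//= h2.
Qed.

Lemma zero_star_lang w : zero_star (lang U) w <-> greedy U w.
Proof.
split=> [[i [w' [/(langP U0 U_incr)[gw _] ->]]]|gw]; first by rewrite greedy_zeros.
exists (find (fun d => d != 0%N) w), (drop (find (fun d => d != 0%N) w) w).
split; last exact: drop_find_zeros.
apply/(langP U0 U_incr); split; last exact: head_drop_find.
by move: gw; rewrite {1}(drop_find_zeros w) greedy_zeros.
Qed.

Lemma lang_catl u w : u != [::] -> lang U u -> greedy U (u ++ w) -> lang U (u ++ w).
Proof.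
move=> u0 /(langP U0 U_incr)[_ hu] guw; apply/(langP U0 U_incr); split=> //.
by case: u u0 hu {guw}.
Qed.

Lemma left_quotient_zeros u p : u != [::] -> lang U u ->
  (forall x, greedy U x -> greedy U (u ++ zeros p ++ x)) ->
  left_quotient (u ++ zeros p) (lang U) = zero_star (lang U).
Proof.
move=> u0 Lu gu; apply/seteqP; split=> w; rewrite /left_quotient /= -catA.
  by move=> /(langP U0 U_incr)[/greedy_catr/greedy_catr gw _]; apply/zero_star_lang.
by move=> /zero_star_lang gw; apply: lang_catl => //; exact: gu.
Qed.

Lemma puv_spec u v : u != [::] -> v != [::] -> lang U u -> lang U v ->
  same_quotient U u v (puv U u v).
Proof.
move=> u0 v0 Lu Lv.
have [gu _] := (langP U0 U_incr u).1 Lu; have [gv _] := (langP U0 U_incr v).1 Lv.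
have [p _ Hp] := filterI (greedy_glue_near gu) (greedy_glue_near gv).
have [pu pv] := Hp p (leqnn p).
have ex : exists p, `[< same_quotient U u v p >].
  by exists p; apply/asboolP; split; apply: left_quotient_zeros.
rewrite /puv (negbTE u0) /=.
suff : exists p, same_quotient U u v p /\ forall q, same_quotient U u v q -> (p <= q)%N.
  by move=> /getPex[].
have [m /asboolP mP mmin] := ex_minnP ex; exists m; split=> // q qP.
exact/mmin/asboolP.
Qed.

Lemma same_quotient_greedy u v p w : same_quotient U u v p -> greedy U w ->
  lang U ((u ++ zeros p) ++ w) /\ lang U ((v ++ zeros p) ++ w).
Proof.
move=> [qu qv] /zero_star_lang gw.
by split; [move: gw; rewrite -qu|move: gw; rewrite -qv].
Qed.

Lemma frac_dense (s e : R) : 0 <= s <= 1 -> 0 < e ->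
  exists2 w, greedy U w & `|frac_word beta w - s| <= e.
Proof.
move=> /andP[s0 s1] e0; have e20 : 0 < e / 2 by rewrite divr_gt0.
have [N _ HN] := filterI (val_word_frac beta_gt1 rt U_rec (t 0) e20) (invU_near e20).
have [vf iU] := HN N (leqnn N); have UN_gt0 := U_gt0 U0 U_incr N.
have UN0 : 0 < (U N)%:R :> R by rewrite ltr0n.
(* The cap matters for s = 1 only, where the truncation would be U N, too large for a word of length
   N. *)
pose m := minn (Num.trunc (s * (U N)%:R)) (U N).-1.
have mU : (m < U N)%N by rewrite (leq_ltn_trans (geq_minr _ _))// ltn_predL.
have gw := greedy_euclid_digits U0 U_incr mU.
exists (euclid_digits U N m) => //.
have := vf _ _ (digits gw) (ltW (frac_lt1 gw)).
rewrite size_euclid_digits leqnn => /(_ isT).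
rewrite val_euclid_digits// subnn expr0 divr1 => h.
have /andP[h1 h2] := truncn_itv (mulr_ge0 s0 (ltW UN0)).
have ms : m%:R <= s * (U N)%:R.
  by apply: le_trans h1; rewrite ler_nat geq_minl.
have sm : s * (U N)%:R <= m%:R + 1.
  rewrite natr1 /m; case: leqP => _; first exact: ltW.
  by rewrite prednK// ler_piMl// ltW.
have h3 : `|m%:R / (U N)%:R - s| <= e / 2.
  have -> : m%:R / (U N)%:R - s = (m%:R - s * (U N)%:R) / (U N)%:R.
    by rewrite mulrBl mulfK// gt_eqF.
  apply: le_trans iU; rewrite normrM normfV (gtr0_norm UN0) ler_piMl ?invr_ge0 ?(ltW UN0)//.
  by rewrite ler_norml; move: ms sm; lra.
rewrite -(subrK (m%:R / (U N)%:R) (frac_word beta _)) -addrA.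
by apply: le_trans (ler_normD _ _) _; move: h h3; rewrite distrC; lra.
Qed.

(** Zeros inserted before the final 1 make its weight negligible and keep the word greedy. The
    length is imposed so that the approximating point has the right scale. *)
Lemma frac_dense_near (s e : R) : 0 <= s <= 1 -> 0 < e ->
  \forall m \near \oo, exists w, [/\ size w = m,
    forall j, greedy U (rcons w 1 ++ zeros j)%N & `|frac_word beta (rcons w 1)%N - s| <= e].
Proof.
move=> s01 e0; have e20 : 0 < e / 2 by rewrite divr_gt0.
have [w gw ws] := frac_dense s01 e20.
have [N _ HN] := filterI (greedy_glue_near gw) (cvg0_near (cvg_exprV beta_gt1) e20).
exists (size w + N)%N => // m /= wm; pose p := (m - size w)%N.
have Np : (N <= p)%N by rewrite /p leq_subRL// (leq_trans _ wm)// leq_addr.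
have [gp ep] := HN p Np.
exists (w ++ zeros p); split=> [|j|].
- by rewrite size_cat size_nseq subnKC// (leq_trans _ wm)// leq_addr.
- by rewrite -cats1 -!catA; apply: gp; exact: greedy_1zeros.
rewrite -cats1 -catA frac_word_cat// frac_word_cat// frac_word_zeros// add0r size_nseq.
rewrite addrAC; apply: le_trans (ler_normD _ _) _.
suff : `|frac_word beta [:: 1%N] / beta ^+ p / beta ^+ size w| <= e / 2.
  by move: ws; lra.
have f1 : frac_word beta [:: 1%N] < 1.
  by apply: frac_lt1; rewrite -[_ :: _]/(1%N :: zeros 0) greedy_1zeros.
have f0 := @frac_word_ge0 R beta [:: 1%N] beta_gt0.
have b0 k : 0 <= beta ^+ k by rewrite exprn_ge0// ltW.
rewrite ger0_norm ?divr_ge0//.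
apply: le_trans (le_trans (ler_norm _) ep); rewrite ler_pdivrMr ?exprn_gt0//.
rewrite [leRHS]mulrC ler_wpM2r ?invr_ge0//.
by rewrite (le_trans (ltW f1))// exprn_ege1// ltW.
Qed.

End Language.

(** * Hausdorff convergence in the plane *)

Section HausdorffMetric.
Local Open Scope classical_set_scope.
Variable R : realType.
Implicit Types (x y z : R * R) (S T K : set (R * R)) (e : R).

(** The sup distance is easier to estimate coordinatewise; it differs from the Euclidean one by at
    most the factor sqrt 2, rounded up to 2 below. *)
Definition near_in_max e x y : Prop := `|x.1 - y.1| <= e /\ `|x.2 - y.2| <= e.

Definition covered e S T : Prop := forall x, S x -> exists2 y, T y & near_in_max e x y.

Lemma near_in_max_sym e x y : near_in_max e x y -> near_in_max e y x.
Proof. by move=> [h1 h2]; split; rewrite distrC. Qed.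

Lemma near_in_max_trans e1 e2 y x z :
  near_in_max e1 x y -> near_in_max e2 y z -> near_in_max (e1 + e2) x z.
Proof.
move=> [xy1 xy2] [yz1 yz2].
by split; [rewrite -(subrK y.1 x.1)|rewrite -(subrK y.2 x.2)];
  rewrite -addrA (le_trans (ler_normD _ _))// lerD.
Qed.

Lemma covered_trans e1 e2 T S K : covered e1 S T -> covered e2 T K -> covered (e1 + e2) S K.
Proof.
move=> ST TK x /ST[y /TK[z Kz yz] xy]; exists z => //; exact: near_in_max_trans xy yz.
Qed.

Lemma euclid_dist_near e x y : near_in_max e x y -> euclid_dist x y <= e *+ 2.
Proof.
move=> [h1 h2]; have e0 : 0 <= e by apply: le_trans h1.
rewrite /euclid_dist -(ger0_norm (mulrn_wge0 2 e0)) -sqrtr_sqr ler_sqrt ?sqr_ge0//.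
rewrite -(real_normK (num_real (x.1 - y.1))) -(real_normK (num_real (x.2 - y.2))).
have s1 : `|x.1 - y.1| ^+ 2 <= e ^+ 2 by rewrite lerXn2r// nnegrE.
have s2 : `|x.2 - y.2| ^+ 2 <= e ^+ 2 by rewrite lerXn2r// nnegrE.
by have := sqr_ge0 e; rewrite exprMn_n; lra.
Qed.

Lemma near_euclid_dist e x y : euclid_dist x y <= e -> near_in_max e x y.
Proof.
rewrite /euclid_dist => h; split; apply: le_trans h; rewrite -sqrtr_sqr ler_sqrt.
- by rewrite lerDl sqr_ge0.
- by rewrite addr_ge0 ?sqr_ge0.
- by rewrite lerDr sqr_ge0.
- by rewrite addr_ge0 ?sqr_ge0.
Qed.

Lemma covered_fattening e S T : covered e S T -> S `<=` fattening T (e *+ 2).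
Proof. by move=> ST x /ST[y Ty xy]; exists y; split=> //; exact: euclid_dist_near. Qed.

Lemma fattening_covered e S T : S `<=` fattening T e -> covered e S T.
Proof. by move=> ST x /ST[y [Ty xy]]; exists y => //; exact: near_euclid_dist. Qed.

Lemma hausdorff_dist_le e S T : 0 <= e -> covered e S T -> covered e T S ->
  0 <= hausdorff_dist S T <= e *+ 2.
Proof.
move=> e0 ST TS; set A := [set e | 0 <= e /\ S `<=` fattening T e /\ T `<=` fattening S e].
have A0 : lbound A 0 by move=> d [].
have Ae : A (e *+ 2) by split; [exact: mulrn_wge0|split; exact: covered_fattening].
apply/andP; split; first by apply: lb_le_inf => //; exists (e *+ 2).
by apply: ge_inf => //; exists 0.
Qed.

Lemma compact_in_box S : compact S -> exists2 b, 0 <= b &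
  forall x, S x -> near_in_max b x (0, 0).
Proof.
move=> /compact_bounded[M [Mr HM]]; exists (`|M| + 1); first by rewrite addr_ge0.
move=> x Sx; have M1 : M < `|M| + 1 by rewrite (le_lt_trans (ler_norm _))// ltrDl.
have : `|x| <= `|M| + 1 := HM _ M1 x Sx.
by rewrite prod_normE ge_max => /andP[]; rewrite /near_in_max /= !subr0.
Qed.

(** Boundedness of both sets makes the set of admissible radii nonempty; otherwise [inf] would take
    a default value and say nothing about S and T. *)
Lemma hausdorff_dist_covered e S T : S !=set0 -> compact S -> T !=set0 -> compact T ->
  hausdorff_dist S T < e -> covered e S T /\ covered e T S.
Proof.
move=> [x0 Sx0] cS [y0 Ty0] cT.
have [b b0 Sb] := compact_in_box cS; have [c c0 Tc] := compact_in_box cT.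
rewrite /hausdorff_dist; set A := [set e | _] => dST.
have cov (S' T' : set (R * R)) (b' c' : R) (y' : R * R) : T' y' ->
    (forall x, S' x -> near_in_max b' x (0, 0)) ->
    (forall x, T' x -> near_in_max c' x (0, 0)) -> covered (b' + c') S' T'.
  move=> Ty Sb' Tc' x Sx; exists y' => //.
  by apply: near_in_max_trans (Sb' _ Sx) _; apply: near_in_max_sym; exact: Tc'.
have hA : has_inf A.
  split; last by exists 0 => d [].
  exists ((b + c) *+ 2); split; first by rewrite mulrn_wge0// addr_ge0.
  split; apply: covered_fattening; first exact: cov Ty0 Sb Tc.
  by rewrite addrC; exact: cov Sx0 Tc Sb.
have := inf_adherent (_ : 0 < e - inf A) hA; rewrite subr_gt0 => /(_ dST).
move=> [d [d0 [/fattening_covered ST /fattening_covered TS]]].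
rewrite addrC subrK => de.
have mono (S' T' : set (R * R)) : covered d S' T' -> covered e S' T'.
  move=> ST' x /ST'[y Ty [h1 h2]]; exists y => //.
  by split; [apply: le_trans h1 _|apply: le_trans h2 _]; exact: ltW.
by split; exact: mono.
Qed.

Lemma hausdorff_cvgP (F : nat -> set (R * R)) K :
  (forall n, F n !=set0 /\ compact (F n)) -> K !=set0 -> compact K ->
  hausdorff_cvg F K <-> (forall e, 0 < e ->
    \forall n \near \oo, covered e (F n) K /\ covered e K (F n)).
Proof.
move=> Fn K0 cK; split=> [[_ _ FK] e e0|FK].
  have e20 : 0 < e / 2 by rewrite divr_gt0.
  have := cvg0_near FK e20; apply: filterS => n dn.
  have [Fn0 cF] := Fn n; apply: hausdorff_dist_covered => //.
  by apply: le_lt_trans (ler_norm _) (le_lt_trans dn _); lra.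
split=> //; apply/cvgr0Pnorm_le => e e0.
have e20 : 0 < e / 2 by rewrite divr_gt0.
apply: filterS (FK _ e20) => n [h1 h2].
have /andP[d0 de] := hausdorff_dist_le (ltW e20) h1 h2.
by rewrite ger0_norm// (le_trans de)// mulr2n -splitr.
Qed.

Lemma covered_closed S K : compact K -> (forall e, 0 < e -> covered e S K) -> S `<=` K.
Proof.
move=> cK SK x Sx.
have /closure_id -> : closed K by apply: compact_closed => //; exact: norm_hausdorff.
move=> B /nbhs_ballP[e /= e0 eB].
have e20 : 0 < e / 2 by rewrite divr_gt0.
have [y Ky [h1 h2]] := SK _ e20 x Sx; exists y; split=> //; apply: eB.
by split; rewrite /ball/=; [apply: le_lt_trans h1 _|apply: le_lt_trans h2 _]; lra.
Qed.

Lemma hausdorff_cvg_unique (F : nat -> set (R * R)) K T :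
  hausdorff_cvg F K -> hausdorff_cvg F T -> K = T.
Proof.
move=> FK FT; have [Fn [K0 cK] _] := FK; have [_ [T0 cT] _] := FT.
move: FK FT => /(hausdorff_cvgP Fn K0 cK) FK /(hausdorff_cvgP Fn T0 cT) FT.
apply/seteqP; split; apply: covered_closed => // e e0; have e20 : 0 < e / 2 by rewrite divr_gt0.
all: have [N _ /(_ N (leqnn N)) [[h1 h2] [h3 h4]]] := filterI (FK _ e20) (FT _ e20).
all: rewrite (splitr e).
  exact: covered_trans h2 h3.
exact: covered_trans h4 h1.
Qed.

(** Total boundedness: the square is cut into finitely many cells of side e/2. One point of D in
    each cell that meets D is approximated within e/2, and it stands for all the others in its
    cell. *)
Lemma covered_uniform (D : set (R * R)) (F : nat -> set (R * R)) (b : R) :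
  (forall z, D z -> (0 <= z.1 <= b) /\ (0 <= z.2 <= b)) ->
  (forall z e, D z -> 0 < e -> \forall n \near \oo, exists2 y, F n y & near_in_max e z y) ->
  forall e, 0 < e -> \forall n \near \oo, covered e D (F n).
Proof.
move=> Db DF e e0; pose h := e / 2; have h0 : 0 < h by rewrite divr_gt0.
pose N := (Num.trunc (b / h)).+1.
pose cell (a : R) (i : nat) := i%:R <= a / h < i.+1%:R.
have cell_ex a : 0 <= a <= b -> exists i : 'I_N, cell a i.
  move=> /andP[a0 ab]; have := truncn_itv (divr_ge0 a0 (ltW h0)) => ai.
  suff iN : (Num.trunc (a / h) < N)%N by exists (Ordinal iN).
  have /andP[_ bN] := truncn_itv (divr_ge0 (le_trans a0 ab) (ltW h0)).
  rewrite -(ltr_nat R); case/andP: ai => ai _; apply: le_lt_trans ai (le_lt_trans _ bN).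
  by rewrite ler_pM2r// invr_gt0.
have cell_near a a' i : cell a i -> cell a' i -> `|a - a'| <= h.
  move=> /andP[h1 h2] /andP[h3 h4]; have : `|a / h - a' / h| <= 1.
    by move: h1 h2 h3 h4; rewrite -natr1 ler_norml; lra.
  by rewrite -mulrBl normrM normfV (gtr0_norm h0) ler_pdivrMr// mul1r.
have : \forall n \near \oo, forall ij : 'I_N * 'I_N, forall z, D z ->
    cell z.1 ij.1 -> cell z.2 ij.2 -> exists2 y, F n y & near_in_max e z y.
  apply: filter_forall => -[i j].
  have [[z0 [Dz0 [c1 c2]]]|N0] := pselect (exists z0, D z0 /\ cell z0.1 i /\ cell z0.2 j).
    apply: filterS (DF z0 h Dz0 h0) => n [y Fy z0y] z Dz /= c1' c2'.
    exists y => //; rewrite (splitr e); apply: near_in_max_trans z0y.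
    by split; [exact: cell_near c1|exact: cell_near c2].
  by apply: nearW => n z Dz c1 c2; case: N0; exists z.
apply: filterS => n Hn z Dz; have [z1 z2] := Db z Dz.
have [i ci] := cell_ex _ z1; have [j cj] := cell_ex _ z2.
exact: (Hn (i, j)).
Qed.

Lemma compact_bigcup_finite (I : choiceType) (D : set I) (F : I -> set (R * R)) :
  finite_set D -> (forall i, D i -> compact (F i)) -> compact (\bigcup_(i in D) F i).
Proof.
move=> fD cF; rewrite -bigsetU_fset_set// big_seq; apply: big_ind.
- exact: compact0.
- exact: compactU.
by move=> i; rewrite in_fset_set// inE => /cF.
Qed.

End HausdorffMetric.

(** * Convergence of the Pascal triangles *)

Lemma val_rep (U : nat -> nat) n : U 0 = 1%N -> (forall n, U n < U n.+1)%N ->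
  val_word U (rep U n) = n.
Proof.
move=> U0 UI; rewrite /rep; set w := euclid_digits U n.+1 n.
rewrite -(val_word_zeros U (find (fun d => d != 0%N) w)) -drop_find_zeros.
by rewrite val_euclid_digits// ltnW// U_gtn.
Qed.

Section PlaneSets.
Local Open Scope classical_set_scope.
Variable R : realType.
Implicit Types (S : set (R * R)) (z : R * R).

Lemma closure_covered S (e : R) : 0 < e -> covered e (closure S) S.
Proof.
move=> e0 z Sz; have [y [Sy [h1 h2]]] := Sz _ (nbhsx_ballx z e e0).
by exists y => //; split; exact: ltW.
Qed.

Lemma subset_covered S (T : set (R * R)) (e : R) : 0 <= e -> S `<=` T -> covered e S T.
Proof. by move=> e0 ST z /ST Tz; exists z => //; split; rewrite subrr normr0. Qed.

Definition square (b : R) : set (R * R) := `[0, b] `*` `[0, b].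

Lemma squareP b z : square b z <-> 0 <= z.1 <= b /\ 0 <= z.2 <= b.
Proof. by rewrite /square /= !in_itv. Qed.

Lemma square_compact b : compact (square b).
Proof. by apply: compact_setX; exact: segment_compact. Qed.

Lemma square_closed b : closed (square b).
Proof. by apply: compact_closed; [exact: norm_hausdorff|exact: square_compact]. Qed.

Lemma closure_square b S : S `<=` square b -> closure S `<=` square b.
Proof. by move=> Sb; rewrite closureE; apply: smallest_sub => //; exact: square_closed. Qed.

Lemma closure_square_compact b S : S `<=` square b -> compact (closure S).
Proof.
move=> Sb; apply: (subclosed_compact (@closed_closure _ S) (@square_compact b)).
exact: closure_square.
Qed.

Lemma affine_compact (a1 b1 a2 b2 : R) S : compact S ->
  compact ((fun z => (a1 + b1 * z.1, a2 + b2 * z.2)) @` S).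
Proof.
move=> cS; apply: continuous_compact => //; apply: continuous_subspaceT => z.
apply: (@cvg_pair _ _ _ _ (nbhs (a1 + b1 * z.1)) (nbhs (a2 + b2 * z.2))) => /=.
  by apply: cvgD; [exact: cvg_cst|apply: cvgMl_tmp; exact: cvg_fst].
by apply: cvgD; [exact: cvg_cst|apply: cvgMl_tmp; exact: cvg_snd].
Qed.

End PlaneSets.

Section Convergence.
Local Open Scope classical_set_scope.
Variables (R : realType) (beta : R) (t : nat -> nat) (r : nat -> R).
Let U := Ubeta beta.
Hypothesis beta_gt1 : 1 < beta.
Hypothesis rt : quasi_greedy beta t r.
Hypothesis U_rec : forall n, U n = (conv t U n n).+1.
Hypothesis ceil_t : ceil_beta beta = (t 0).+1.
Implicit Types (u v w : seq nat) (n : nat) (e s : R) (z : R * R).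

Let beta_gt0 : 0 < beta. Proof. exact: lt_trans beta_gt1. Qed.
Let beta_neq0 : beta != 0. Proof. by rewrite gt_eqF. Qed.
Let bn_gt0 n : 0 < beta ^+ n. Proof. exact: exprn_gt0. Qed.
Let bn_ge0 n : 0 <= beta ^+ n. Proof. exact: ltW. Qed.
Let bn_neq0 n : beta ^+ n != 0. Proof. by rewrite gt_eqF. Qed.
Let bV_le1 n : (beta ^+ n)^-1 <= 1. Proof. by rewrite invf_le1// exprn_ege1// ltW. Qed.
Let U0 : U 0 = 1%N. Proof. exact: quasi_greedy_U0 U_rec. Qed.
Let U_incr n : (U n < U n.+1)%N. Proof. exact: U_ltn beta_gt1 rt U_rec n. Qed.
Let Un_gt0 n : 0 < (U n)%:R :> R. Proof. by rewrite ltr0n (U_gt0 U0 U_incr). Qed.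
Let frac_lt1 w : greedy U w -> frac_word beta w < 1.
Proof. exact: frac_word_lt1 beta_gt1 rt U_rec w. Qed.
Let frac_ge0 w : 0 <= frac_word beta w. Proof. exact: frac_word_ge0. Qed.
Let digits w : greedy U w -> all (fun a => a <= t 0)%N w.
Proof. exact: greedy_digits beta_gt1 rt U_rec w. Qed.
Let langUP w : lang U w <-> greedy U w /\ head 1%N w != 0%N.
Proof. exact: langP. Qed.

Definition real_val w : R := frac_word beta w * beta ^+ size w.

Lemma real_val_cat u w : real_val (u ++ w) = real_val u * beta ^+ size w + real_val w.
Proof.
by rewrite /real_val frac_word_cat// size_cat exprD; field; rewrite bn_neq0.
Qed.

Lemma real_val_zeros k : real_val (zeros k) = 0.
Proof. by rewrite /real_val frac_word_zeros// mul0r. Qed.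

Lemma frac_word_pad k w : frac_word beta (zeros k ++ w) = real_val w / beta ^+ (k + size w).
Proof.
rewrite /real_val frac_word_cat// frac_word_zeros// add0r size_nseq exprD.
by field; rewrite !bn_neq0.
Qed.

Lemma real_valE w n : (size w <= n)%N ->
  real_val w / beta ^+ n = frac_word beta w / beta ^+ (n - size w).
Proof.
move=> wn; have -> : beta ^+ n = beta ^+ (n - size w) * beta ^+ size w.
  by rewrite -exprD subnK.
by rewrite /real_val; field; rewrite !bn_neq0.
Qed.

Lemma real_val_itv w n : greedy U w -> (size w <= n)%N -> 0 <= real_val w / beta ^+ n <= 1.
Proof.
move=> gw wn; rewrite real_valE// divr_ge0//= ler_pdivrMr// mul1r.
by rewrite (le_trans (ltW (frac_lt1 gw)))// exprn_ege1// ltW.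
Qed.

Lemma odd_word_binom_size u v : odd (word_binom u v) -> (size v <= size u)%N.
Proof.
move=> ouv; apply: size_subseq; rewrite -word_binom_gt0 lt0n.
by apply: contraTneq ouv => ->.
Qed.

Definition word_points n : set (R * R) :=
  [set z | exists u v, [/\ lang U u, lang U v, (size u <= n)%N & odd (word_binom u v)] /\
     z = (real_val v / beta ^+ n, real_val u / beta ^+ n)].

Lemma U_set_word_points e : 0 < e -> \forall n \near \oo,
  covered e (U_set beta n) (word_points n) /\ covered e (word_points n) (U_set beta n).
Proof.
move=> e0; have e20 : 0 < e / 2 by rewrite divr_gt0.
apply: filterS (filterI (val_word_frac beta_gt1 rt U_rec (t 0) e20)
  (invU_near beta_gt1 rt U_rec e20)) => n [vf iU].
have close w q : lang U w -> (size w <= n)%N -> 0 <= q <= 1 ->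
    `|((val_word U w)%:R + q) / (U n)%:R - real_val w / beta ^+ n| <= e.
  move=> /langUP[gw _] wn /andP[q0 q1].
  have := vf w wn (digits gw) (ltW (frac_lt1 gw)).
  rewrite real_valE// mulrDl; have : 0 <= q / (U n)%:R <= e / 2.
    by rewrite divr_ge0 ?(ltW (Un_gt0 _))//= (le_trans _ iU)// ler_piMl// invr_ge0 ltW.
  by rewrite !ler_norml; lra.
split=> z [u [v [[Lu Lv un ouv] H]]]; have vn := leq_trans (odd_word_binom_size ouv) un.
  have [q [q1 [q2 ->]]] := H.
  exists (real_val v / beta ^+ n, real_val u / beta ^+ n); first by exists u, v.
  by split; apply: close.
exists ((val_word U v)%:R / (U n)%:R, (val_word U u)%:R / (U n)%:R).
  exists u, v; split=> //; exists (0, 0); rewrite /= lexx ler01 !addr0.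
  by split=> //; split.
rewrite H; apply: near_in_max_sym.
by split; rewrite /= -[X in X / (U n)%:R]addr0; apply: close; rewrite ?lexx ?ler01.
Qed.

Lemma iter_c_map i z : iter i (c_map beta) z = (z.1 / beta ^+ i, z.2 / beta ^+ i).
Proof.
elim: i => [|i IH]; first by rewrite expr0 !divr1; case: z.
by rewrite iterS IH /c_map /= exprSr !invfM !mulrA.
Qed.

Lemma iter_h_map j z : iter j (h_map beta) z = (z.1, beta ^+ j * z.2).
Proof.
elim: j => [|j IH]; first by rewrite expr0 mul1r; case: z.
by rewrite iterS IH /h_map /= exprS mulrA.
Qed.

Definition hc i j z : R * R := (z.1 / beta ^+ i, beta ^+ j * (z.2 / beta ^+ i)).

Lemma A_setP n z : A_set beta n z <->
  exists i j z0, [/\ (j <= i <= n)%N, A0_set beta z0 & z = hc i j z0].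
Proof.
split=> [[i [j [jin [z0 Az0 <-]]]]|[i [j [z0 [jin Az0 ->]]]]].
  by exists i, j, z0; split; rewrite // iter_h_map iter_c_map.
by exists i, j; split=> //; exists z0; rewrite ?iter_h_map ?iter_c_map.
Qed.

Lemma segment_uvE u v s : (size v <= size u)%N ->
  (frac_word beta (zeros (size u - size v) ++ v) + s * beta ^- (size u + puv U u v),
   frac_word beta u + s * beta ^- (size u + puv U u v)) =
  ((real_val v + s / beta ^+ puv U u v) / beta ^+ size u,
   (real_val u + s / beta ^+ puv U u v) / beta ^+ size u).
Proof.
move=> vu; move: (puv U u v) => p.
rewrite frac_word_pad subnK// exprD /real_val.
by congr pair; field; rewrite !bn_neq0.
Qed.

Lemma cond_star_size u v : cond_star beta u v -> (size v <= size u)%N.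
Proof. by move=> [_ [_ [[-> ->]//|[/andP[]]]]]. Qed.

(** The bound 2 is 1 for the endpoint A, which lies in the unit square, plus 1 for the diagonal
    step. *)
Lemma segment_square u v z : cond_star beta u v -> segment_uv beta u v z -> square 2 z.
Proof.
move=> uv; have vu := cond_star_size uv; have [/langUP[gu _] [/langUP[gv _] _]] := uv.
move=> [s [/andP[s0 s1]]]; rewrite segment_uvE// => ->; apply/squareP => /=.
rewrite !mulrDl; move: (puv U u v) => p.
have : 0 <= s / beta ^+ p / beta ^+ size u <= 1.
  rewrite !divr_ge0//= -mulrA -invfM mulr_ile1// ?invr_ge0 ?mulr_ge0//.
  by rewrite -exprD.
have := real_val_itv gv vu; have := real_val_itv gu (leqnn _).
move: (_ / _) (_ / _) (_ / _) => a b c.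
by move=> /andP[? ?] /andP[? ?] /andP[? ?]; split; apply/andP; split; lra.
Qed.

Let segments_square :
  [set z | exists u v, cond_star beta u v /\ segment_uv beta u v z] `<=` square 2.
Proof. by move=> z [u [v [uv suv]]]; exact: segment_square suv. Qed.

Lemma A0_square : A0_set beta `<=` square 2.
Proof. exact: closure_square segments_square. Qed.

(** The empty pair has p = 0, so its segment is the full diagonal of the unit square. *)
Lemma diagonal_A0 s : 0 <= s <= 1 -> A0_set beta (s, s).
Proof.
move=> s01; apply: subset_closure; exists [::], [::].
have Lnil : lang U [::] by apply/langUP.
split; first by split=> //; split=> //; left.
exists s; split=> //; rewrite /= frac_word_nil /puv /= !add0r.
by rewrite expr0 invr1 mulr1.
Qed.

Lemma hc_square i j z : (j <= i)%N -> square 2 z -> square 2 (hc i j z).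
Proof.
move=> ji /squareP[/andP[z10 z12] /andP[z20 z22]]; apply/squareP => /=.
have -> : beta ^+ j * (z.2 / beta ^+ i) = z.2 / beta ^+ (i - j).
  by rewrite -{1}(subnK ji) exprD; field; rewrite !bn_neq0.
rewrite !divr_ge0//= !ler_pdivrMr//.
by split; [apply: (le_trans z12)|apply: (le_trans z22)]; rewrite ler_peMr// exprn_ege1// ltW.
Qed.

(** For j <= i the two scaling factors beta^-i and beta^(j-i) are at most 1. *)
Lemma hc_near i j e x y : (j <= i)%N -> near_in_max e x y -> near_in_max e (hc i j x) (hc i j y).
Proof.
move=> ji [h1 h2]; rewrite /near_in_max /= -mulrBl -mulrBr -mulrBl.
rewrite !normrM !normfV !(ger0_norm (bn_ge0 _)); split.
  by apply: le_trans h1; rewrite ler_piMr.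
apply: le_trans h2; rewrite mulrCA ler_piMr//.
by rewrite -(subnK ji) exprD invfM mulrCA mulfV// mulr1.
Qed.

Lemma A_set_mono n m : (n <= m)%N -> A_set beta n `<=` A_set beta m.
Proof.
by move=> nm z [i [j [/andP[ji jn] H]]]; exists i, j; rewrite ji (leq_trans jn nm).
Qed.

Lemma A_set_square n : A_set beta n `<=` square 2.
Proof.
by move=> z /A_setP[i [j [z0 [/andP[ji _] /A0_square Az0 ->]]]]; exact: hc_square.
Qed.

Lemma A_set_compact n : compact (A_set beta n).
Proof.
pose D : set (nat * nat) := [set ij | (ij.2 <= ij.1 <= n)%N].
have -> : A_set beta n = \bigcup_(ij in D)
    ((fun z => (0 + (beta ^+ ij.1)^-1 * z.1, 0 + beta ^+ ij.2 / beta ^+ ij.1 * z.2))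
       @` A0_set beta).
  have hcE i j z : (0 + (beta ^+ i)^-1 * z.1, 0 + beta ^+ j / beta ^+ i * z.2) = hc i j z.
    by rewrite /hc !add0r; congr pair; [rewrite mulrC|rewrite mulrAC mulrA].
  apply/seteqP; split=> z.
    by move=> /A_setP[i [j [z0 [jin Az0 ->]]]]; exists (i, j) => //; exists z0.
  move=> [[i j] /= jin [z0 Az0]]; rewrite hcE => <-.
  by apply/A_setP; exists i, j, z0.
apply: compact_bigcup_finite => [|ij _].
  apply: (@sub_finite_set _ _ (`I_n.+1 `*` `I_n.+1)); last exact: finite_setX.
  by move=> [i j] /= /andP[ji jn]; rewrite /= !ltnS (leq_trans ji jn).
apply: affine_compact; exact: closure_square_compact segments_square.
Qed.

Lemma A_set_nonempty n : A_set beta n !=set0.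
Proof.
exists (hc 0 0 (0, 0)); apply/A_setP; exists 0%N, 0%N, (0, 0); split=> //.
by apply: diagonal_A0; rewrite lexx ler01.
Qed.

Lemma U_set_nonempty n : U_set beta n !=set0.
Proof.
have Lnil : lang U [::] by apply/langUP.
exists ((val_word U [::])%:R / (U n)%:R, (val_word U [::])%:R / (U n)%:R).
exists [::], [::]; split; first by rewrite word_binom_nil.
by exists (0, 0); rewrite /= lexx ler01 !addr0.
Qed.

Lemma U_set_compact n : compact (U_set beta n).
Proof.
pose D : set (seq nat * seq nat) :=
  [set uv | [/\ lang U uv.1, lang U uv.2, (size uv.1 <= n)%N & odd (word_binom uv.1 uv.2)]].
have -> : U_set beta n = \bigcup_(uv in D) ((fun z : R * R =>
    ((val_word U uv.2)%:R / (U n)%:R + (U n)%:R^-1 * z.1,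
     (val_word U uv.1)%:R / (U n)%:R + (U n)%:R^-1 * z.2)) @` square 1).
  apply/seteqP; split=> z.
    move=> [u [v [uvD [q [q1 [q2 ->]]]]]]; exists (u, v) => //.
    by exists q; [exact/squareP|rewrite !mulrDl [q.1 / _]mulrC [q.2 / _]mulrC].
  move=> [[u v] uvD [q /squareP[q1 q2] <-]]; exists u, v; split=> //.
  by exists q; split=> //; split=> //; rewrite !mulrDl [q.1 / _]mulrC [q.2 / _]mulrC.
apply: compact_bigcup_finite => [|uv _]; last exact/affine_compact/square_compact.
apply: (@sub_finite_set _ _
  ((fun ab => (rep U ab.1, rep U ab.2)) @` (`I_(U n) `*` `I_(U n)))); last first.
  by apply: finite_image; exact: finite_setX.
have in_rep w : lang U w -> (size w <= n)%N -> exists2 a, (a < U n)%N & rep U a = w.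
  move=> Lw wn; have [a _ aw] := Lw; exists a => //.
  have [/(greedy_val U0) gw _] := (langUP w).1 Lw.
  rewrite -(val_rep a U0 U_incr) aw; apply: leq_trans gw _.
  exact: leq_U.
move=> [u v] [/= Lu Lv un ouv].
have [a aU aE] := in_rep u Lu un.
have [b bU bE] := in_rep v Lv (leq_trans (odd_word_binom_size ouv) un).
by exists (a, b) => //; rewrite /= aE bE.
Qed.

Lemma word_points_covered n : covered (beta ^+ n)^-1 (word_points n) (A_set beta n).
Proof.
move=> z [u [v [[Lu Lv un ouv] ->]]].
have [gu _] := (langUP u).1 Lu.
have vu := odd_word_binom_size ouv.
(* For empty v the word v0^k1 starts with a zero, hence is not in L. The point (0,y) is instead
   within beta^-n of (y/beta^n, y), the image of (y,y) under h^n c^n. *)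
have [v0|v0] := eqVneq v [::].
  move: (real_val u / _) (real_val_itv gu un) => y y01.
  exists (hc n n (y, y)).
    by apply/A_setP; exists n, n, (y, y); split; rewrite ?leqnn//; exact: diagonal_A0.
  have -> : real_val v = 0 by rewrite v0 /real_val frac_word_nil mul0r.
  rewrite /near_in_max /= mul0r sub0r normrN; case/andP: y01 => y0 y1; split.
    by rewrite ger0_norm ?divr_ge0// ler_piMl// invr_ge0.
  by rewrite mulrCA mulfV// mulr1 subrr normr0 invr_ge0.
have u0 : u != [::] by apply: contra_neq v0 => u0; case: v vu {Lv ouv} => //; rewrite u0.
have [p quv] : exists p, same_quotient U u v p.
  by exists (puv U u v); exact: (puv_spec beta_gt1 rt U_rec u0 v0 Lu Lv).
(* A power of 2 above |u|, for the parity, and above p, so that the lengthened words stay in L. *)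
pose k := (2 ^ (size u + p))%N.
have pk : (p <= k)%N by rewrite (leq_trans (leq_addl (size u) p))// ltnW// ltn_expl.
have uk : (size u < k)%N by rewrite (leq_ltn_trans (leq_addr p _))// ltn_expl.
pose x := zeros k ++ [:: 1%N].
have gx j : greedy U (zeros j ++ [:: 1%N]).
  by rewrite greedy_zeros//; exact: (greedy_1zeros U0 U_incr 0).
have xE : x = zeros p ++ zeros (k - p) ++ [:: 1%N].
  by rewrite /x catA /zeros -nseqD subnKC.
have [Lux Lvx] : lang U (u ++ x) /\ lang U (v ++ x).
  rewrite xE (catA u) (catA v).
  exact: (same_quotient_greedy beta_gt1 rt U_rec quv (gx (k - p)%N)).
have star : cond_star beta (u ++ x) (v ++ x).
  split=> //; split=> //; right; set q := puv _ _ _.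
  (* The pair is rigid before the zeros 0^q are appended, hence also after, whatever the value of
     q. *)
  have [] := rigid_cat (all_predT (zeros q)) (rigid_zeros1 ouv uk).
  move=> o1 o2; split=> // [|a _]; last exact: o2.
  by rewrite !size_cat leq_add2r vu !addnA addn1.
pose f := frac_word beta x.
have f01 : 0 <= f <= 1 by rewrite frac_ge0 ltW// frac_lt1 ?gx.
have ux : (size (v ++ x) <= size (u ++ x))%N := cond_star_size star.
clearbody x.
pose z0 : R * R := ((real_val v + f) / beta ^+ size u, (real_val u + f) / beta ^+ size u).
have Az0 : A0_set beta z0.
  apply: subset_closure; exists (u ++ x), (v ++ x); split=> //.
  (* The endpoint A of the segment: the suffix x moves it by f = 0.x < 1 below the last letter,
     hence the final distance f / beta^n. *)
  exists 0; split; first by rewrite lexx ler01.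
  rewrite segment_uvE// mul0r !addr0 !real_val_cat size_cat exprD /z0 /f /real_val.
  by congr pair; field; rewrite !bn_neq0.
exists (hc (n - size u) 0 z0).
  by apply/A_setP; exists (n - size u)%N, 0%N, z0; split; rewrite // leq_subr.
have bnE : beta ^+ n = beta ^+ size u * beta ^+ (n - size u) by rewrite -exprD subnKC.
have fn : `|- (f / beta ^+ n)| <= (beta ^+ n)^-1.
  case/andP: f01 => f0 f1; rewrite normrN ger0_norm ?divr_ge0//.
  by rewrite ler_piMl// invr_ge0.
have close a : a / beta ^+ n - (a + f) / beta ^+ size u / beta ^+ (n - size u) =
    - (f / beta ^+ n).
  by rewrite bnE; field; rewrite !bn_neq0.
by rewrite /near_in_max /= expr0 mul1r !close.
Qed.

(** The words are described by their values and a length bound, not explicitly: for the empty pair,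
    leading zeros must be erased to remain in L. *)
Lemma cond_star_extend u v w j : cond_star beta u v ->
  (forall i, greedy U (rcons w 1%N ++ zeros i)) ->
  exists u' v', [/\ lang U u', lang U v', odd (word_binom u' v'),
    (size u' <= size u + puv U u v + (size w).+1 + j)%N &
    real_val u' = real_val ((u ++ zeros (puv U u v)) ++ rcons w 1%N ++ zeros j) /\
    real_val v' = real_val ((v ++ zeros (puv U u v)) ++ rcons w 1%N)].
Proof.
move=> [Lu [Lv uv]] gw; have one0 i : 1%N \notin zeros i by rewrite mem_nseq andbF.
have gw0 : greedy U (rcons w 1%N) by have := gw 0%N; rewrite cats0.
case: uv => [[uE vE]|[/andP[v0 vu] ouv uv0]].
  have -> : puv U u v = 0%N by rewrite uE vE.
  subst u v; rewrite !cats0 !cat0s.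
  pose k := find (fun d => d != 0%N) w; pose w' := drop k w.
  have wE : rcons w 1%N = zeros k ++ rcons w' 1%N.
    by rewrite {1}(drop_find_zeros w) rcons_cat.
  have hw' i : head 1%N (rcons w' 1%N ++ zeros i) != 0%N.
    by have := head_drop_find w; rewrite -/k -/w'; case: w' {wE}.
  have gw' i : greedy U (rcons w' 1%N ++ zeros i).
    by have := gw i; rewrite wE -catA => /greedy_catr.
  have rv0 x : real_val (zeros k ++ x) = real_val x.
    by rewrite real_val_cat real_val_zeros mul0r add0r.
  exists (rcons w' 1%N ++ zeros j), (rcons w' 1%N); split.
  - exact/langUP.
  - by apply/langUP; have := hw' 0%N; have := gw' 0%N; rewrite cats0.
  - rewrite word_binom_cat_notin//.
    have rnil : rigid predT [::] [::].
      by split=> [|a _]; [rewrite word_binom_nil|exact: word_binom_size].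
    by have [] := rigid_cat (all_predT (rcons w' 1%N)) rnil.
  - rewrite size_cat size_nseq leq_add2r size_rcons !add0n ltnS.
    by rewrite size_drop leq_subr.
  - by rewrite wE -catA !rv0.
have u0 : u != [::] by case: u vu {Lu ouv uv0} => //; rewrite leqn0 => /eqP vE; rewrite vE in v0.
have v0' : v != [::] by case: v v0 {Lv vu ouv uv0}.
have quv := puv_spec beta_gt1 rt U_rec u0 v0' Lu Lv.
exists ((u ++ zeros (puv U u v)) ++ rcons w 1%N ++ zeros j),
  ((v ++ zeros (puv U u v)) ++ rcons w 1%N); split=> //.
- by have [] := same_quotient_greedy beta_gt1 rt U_rec quv (gw j).
- by have [] := same_quotient_greedy beta_gt1 rt U_rec quv gw0.
- rewrite [X in word_binom X _]catA -[X in word_binom _ X]rcons_cat word_binom_cat_notin// rcons_cat.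
  have [] // := @rigid_cat (fun a => a < ceil_beta beta)%N _ _ (rcons w 1%N) _ (conj ouv uv0).
  by rewrite ceil_t; exact: digits.
by rewrite !size_cat !size_nseq size_rcons addnA.
Qed.

Lemma A_set_word_points n z e : A_set beta n z -> 0 < e ->
  \forall m \near \oo, exists2 y, word_points m y & near_in_max e z y.
Proof.
move=> /A_setP[i [j [z0 [/andP[ji _] Az0 ->]]]] e0.
have e20 : 0 < e / 2 by rewrite divr_gt0.
have [z1 [u [v [uv [s [s01 z1E]]]]] z01] := closure_covered e20 Az0.
have vu := cond_star_size uv; rewrite segment_uvE// in z1E.
have [M _ HM] := frac_dense_near beta_gt1 rt U_rec s01 e20.
exists (size u + puv U u v + M.+1 + i)%N => // m /= Mm.
(* With this length, u0^p w1 has m - i letters: scaling by beta^m instead of beta^(m-i) realises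
   c^i, and the j <= i zeros appended to the first word realise h^j within length m. *)
pose l := (m - (size u + puv U u v + 1 + i))%N.
have mE : m = (size u + puv U u v + l.+1 + i)%N by rewrite /l; clear - Mm; lia.
have Ml : (M <= l)%N by rewrite /l; clear - Mm; lia.
have [w [wl gw ws]] := HM l Ml.
have [u' [v' [Lu' Lv' ouv' su' [ru rv]]]] := cond_star_extend j uv gw.
exists (real_val v' / beta ^+ m, real_val u' / beta ^+ m).
  exists u', v'; split=> //; split=> //; apply: leq_trans su' _.
  by rewrite wl mE leq_add2l.
rewrite (splitr e); apply: near_in_max_trans (hc_near ji z01) _.
pose f := frac_word beta (rcons w 1%N); pose p := puv U u v.
have fs : near_in_max (e / 2) z1
   ((real_val v + f / beta ^+ p) / beta ^+ size u, (real_val u + f / beta ^+ p) / beta ^+ size u).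
  have H a : `|(a + s / beta ^+ p) / beta ^+ size u - (a + f / beta ^+ p) / beta ^+ size u| <= e / 2.
    clearbody p; have -> : (a + s / beta ^+ p) / beta ^+ size u - (a + f / beta ^+ p) / beta ^+ size u =
      (s - f) / beta ^+ (p + size u) by rewrite exprD; field; rewrite !bn_neq0.
    rewrite normrM normfV (ger0_norm (bn_ge0 _)) distrC.
    by apply: le_trans ws; rewrite ler_piMr.
  by rewrite z1E; split; exact: H.
have := hc_near ji fs; rewrite /hc /=.
suff [-> ->] : (real_val v + f / beta ^+ p) / beta ^+ size u / beta ^+ i = real_val v' / beta ^+ m /\
   beta ^+ j * ((real_val u + f / beta ^+ p) / beta ^+ size u / beta ^+ i) = real_val u' / beta ^+ m.
  by [].
rewrite ru rv mE !real_val_cat !real_val_zeros !size_cat !size_nseq size_rcons wl.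
rewrite -/p addr0 !exprD [real_val (rcons _ _)]/real_val size_rcons wl -/f.
clearbody p f l; move: (real_val u) (real_val v) (size u) => a b c.
by split; field; rewrite !bn_neq0.
Qed.

Definition A_union : set (R * R) := \bigcup_n A_set beta n.

Lemma A_union_square : A_union `<=` square 2.
Proof. by move=> z [n _]; exact: A_set_square. Qed.

Let A_union_itv z : A_union z -> 0 <= z.1 <= 2 /\ 0 <= z.2 <= 2.
Proof. by move=> /A_union_square/squareP. Qed.

Lemma closure_A_union_nonempty : closure A_union !=set0.
Proof.
have [z Az] := A_set_nonempty 0; exists z; apply: subset_closure.
by exists 0%N.
Qed.

Lemma A_set_closure n : A_set beta n `<=` closure A_union.
Proof. by move=> z Az; apply: subset_closure; exists n. Qed.

Lemma A_set_cvg : hausdorff_cvg (A_set beta) (closure A_union).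
Proof.
apply/hausdorff_cvgP.
- by move=> n; split; [exact: A_set_nonempty|exact: A_set_compact].
- exact: closure_A_union_nonempty.
- exact: closure_square_compact A_union_square.
move=> e e0; have e20 : 0 < e / 2 by rewrite divr_gt0.
have DA : \forall n \near \oo, covered (e / 2) A_union (A_set beta n).
  apply: (covered_uniform A_union_itv) => // z d [n _ Anz] d0.
  exists n => // m /= nm; exists z; first exact: A_set_mono Anz.
  by split; rewrite subrr normr0 ltW.
apply: filterS DA => n DA.
split; first by apply: subset_covered; [exact: ltW|exact: A_set_closure].
by rewrite (splitr e); apply: covered_trans DA; exact: closure_covered.
Qed.

Lemma U_set_cvg : hausdorff_cvg (U_set beta) (closure A_union).
Proof.
apply/hausdorff_cvgP.
- by move=> n; split; [exact: U_set_nonempty|exact: U_set_compact].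
- exact: closure_A_union_nonempty.
- exact: closure_square_compact A_union_square.
move=> e e0; have e20 : 0 < e / 2 by rewrite divr_gt0.
have e40 : 0 < e / 2 / 2 by rewrite divr_gt0.
have DX : \forall n \near \oo, covered (e / 2 / 2) A_union (word_points n).
  by apply: (covered_uniform A_union_itv) => // z d [n _ Az]; exact: A_set_word_points Az.
have bn := cvg0_near (cvg_exprV beta_gt1) e20.
apply: filterS (filterI (U_set_word_points e20) (filterI (U_set_word_points e40) (filterI DX bn))).
move=> n [[UX _] [[_ XU] [DXn bnn]]]; split.
  rewrite (splitr e); apply: covered_trans UX _ => z /word_points_covered[y Ay [h1 h2]].
  have bn2 := le_trans (ler_norm _) bnn.
  exists y; first exact: A_set_closure Ay.
  by split; [exact: le_trans bn2|exact: le_trans bn2].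
rewrite (splitr e); apply: covered_trans (closure_covered e20) _.
by rewrite (splitr (e / 2)); exact: covered_trans DXn XU.
Qed.

End Convergence.

Theorem theorem46 (R : realType) (beta : R) (hbeta : 1 < beta)
  (hparry : parry beta) :
  hausdorff_cvg (U_set beta) (limit_set beta).
Proof.
have [t [r [rt Urec ct]]] := Ubeta_quasi_greedy hbeta hparry.
have AK := A_set_cvg hbeta rt Urec.
suff -> : limit_set beta = closure (A_union beta) by exact: (U_set_cvg hbeta rt Urec ct).
(* [limit_set] is a chosen limit, so uniqueness of Hausdorff limits is what identifies it. *)
by apply: (hausdorff_cvg_unique _ AK); apply: getPex; exists (closure (A_union beta)).
Qed.
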